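(* Let $G$ be a $K_4$-minor-free graph and $x,y,z$ distinct vertices of $G$. If $\{x,y,z\}$ is feasible, then $G$ is $(2,2,2)$-AT extendable with respect to $(x,y,z)$.
   Context: All graphs are finite and simple. For an orientation $D$ of a graph $G$, an Eulerian sub-digraph of $D$ is a spanning sub-digraph $F$ of $D$ with $d^+_F(v)=d^-_F(v)$ for every vertex $v$. Let $\mathrm{diff}(D)$ be the number of Eulerian sub-digraphs of $D$ with an even number of arcs minus the number with an odd number of arcs; $D$ is an AT-orientation if $\mathrm{diff}(D)\neq 0$. For $f:V(G)\to\mathbb{N}$, $G$ is $f$-AT if $G$ has an AT-orientation $D$ with $d^+_D(v)\le f(v)-1$ for every vertex $v$. Given distinct vertices $v_1,\dots,v_k$ and integers $a_i\in\{1,2\}$, define $f(v_i)=a_i$ for $i\in[k]$ and $f(v)=3$ for all other vertices; $G$ is $(a_1,\dots,a_k)$-AT extendable with respect to $(v_1,\dots,v_k)$ if $G$ is $f$-AT. For $n\in\mathbb{N}$, the chain of diamonds $D_n$ is the graph with vertex set $\{u_i,v_i,w_i:i\in[n]\}\cup\{u_0\}$ and edge set $\{u_{i-1}v_i,u_{i-1}w_i,v_iw_i,v_iu_i,w_iu_i: i\in[n]\}$; let $U(D_n)=\{u_0,\dots,u_n\}$. A set $X$ of distinct vertices of $G$ is connected by a chain of diamonds if there exist $n\in\mathbb{N}$ and a graph homomorphism $\varphi:D_n\to G$ with $X\subseteq\varphi(U(D_n))$. A set $X$ of three distinct vertices of $G$ is feasible if $X$ is not connected by a chain of diamonds and there is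 a proper $3$-coloring $\phi$ of $G$ with $|\phi(X)|\le 2$. *)

(* Defs.v *)
From mathcomp Require Import all_boot all_order all_algebra.
Set Implicit Arguments. Unset Strict Implicit. Unset Printing Implicit Defensive.
Import GRing.Theory Num.Theory.

Definition simple_graph (T : finType) (e : rel T) : Prop :=
  symmetric e /\ irreflexive e.

Definition induced_connected (T : finType) (e : rel T) (A : {set T}) : Prop :=
  forall x y, x \in A -> y \in A ->
    connect [rel a b | [&& e a b, a \in A & b \in A]] x y.

Definition has_K4_minor (T : finType) (e : rel T) : Prop :=
  exists B : 'I_4 -> {set T},
    [/\ forall i, B i != set0,
        forall i j, i != j -> [disjoint B i & B j],
        forall i, induced_connected e (B i) &
        forall i j, i != j -> exists x y, [/\ x \in B i, y \in B j & e x y]].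

Definition K4_minor_free (T : finType) (e : rel T) : Prop := ~ has_K4_minor e.

Definition orientation (T : finType) (e : rel T) (d : rel T) : Prop :=
  (forall x y, d x y -> e x y) /\ (forall x y, e x y -> d x y != d y x).

Definition outdeg (T : finType) (d : rel T) (v : T) : nat := #|[set y | d v y]|.

(* Spanning Eulerian sub-digraphs of d, given by their arc sets. *)
Definition eulerian_sub (T : finType) (d : rel T) (F : {set T * T}) : bool :=
  [forall a in F, d a.1 a.2] &&
  [forall v, #|[set a in F | a.1 == v]| == #|[set a in F | a.2 == v]|].

Definition diffD (T : finType) (d : rel T) : int :=
  \sum_(F : {set T * T} | eulerian_sub d F) (-1) ^+ #|F|.

Definition AT_orientation (T : finType) (d : rel T) : Prop := diffD d != 0.

Definition f_AT (T : finType) (e : rel T) (f : T -> nat) : Prop :=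
  exists d : rel T, [/\ orientation e d, AT_orientation d &
                        forall v, outdeg d v <= f v - 1].

Definition f222 (T : finType) (x y z : T) (v : T) : nat :=
  if (v == x) || (v == y) || (v == z) then 2 else 3.

Definition AT_extendable_222 (T : finType) (e : rel T) (x y z : T) : Prop :=
  f_AT e (f222 x y z).

(* Graph homomorphism from the chain of diamonds D_n into (T,e):
   u i (0 <= i <= n) is the image of u_i, v i and w i (0 <= i < n) are
   the images of v_{i+1} and w_{i+1}. *)
Definition diamond_hom (T : finType) (e : rel T) (n : nat) (u v w : nat -> T) : Prop :=
  forall i, i < n ->
    [/\ e (u i) (v i), e (u i) (w i), e (v i) (w i),
        e (v i) (u i.+1) & e (w i) (u i.+1)].

Definition connected_by_chain_of_diamonds (T : finType) (e : rel T) (X : {set T}) : Prop :=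
  exists n (u v w : nat -> T), diamond_hom e n u v w /\
    (forall a, a \in X -> exists2 i, i <= n & u i = a).

Definition proper_3_coloring (T : finType) (e : rel T) (c : T -> 'I_3) : Prop :=
  forall a b, e a b -> c a != c b.

Definition feasible (T : finType) (e : rel T) (x y z : T) : Prop :=
  ~ connected_by_chain_of_diamonds e [set x; y; z] /\
  exists c : T -> 'I_3, proper_3_coloring e c /\ #|[set c x; c y; c z]| <= 2.

(* Main.v *)
Require Import Defs.
From mathcomp Require Import all_boot all_order all_algebra.
From mathcomp Require Import zify ring mpoly.
Set Implicit Arguments. Unset Strict Implicit. Unset Printing Implicit Defensive.
Import GRing.Theory.

(** Let P be the product of X_u + X_v over the edges uv of G, over F_2, and let
   I be the ideal of all cubes X_v^3. The coefficient of P at the out-degree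
   sequence of an orientation D is diff(D) mod 2, so it suffices to prove that
   X_x X_y X_z P is not in I; here x, y, z are allowed to coincide.

   Modulo (I : P) a triangle abc gives X_a + X_b + X_c = 0, hence the opposite
   corners of a diamond are equal, and an edge ab gives
   X_a^2 + X_a X_b + X_b^2 = 0. In a 2-tree every variable is therefore one of
   the three nonzero linear forms in the ends of an edge bc; completing G to a
   2-tree shows that X_b X_y X_z P and X_c X_y X_z P are never both in I, and
   that X_y X_z P is not in I.

   Take a counterexample with fewest edges. A vertex of degree at most 2 outside
   {x, y, z} can be deleted. If x has degree 2 and neighbours a, b, extracting
   the coefficient of X_x^2 replaces X_x by X_a + X_b; if ab is not an edge this
   is the factor of a new edge ab, and only two special vertices remain. If ab
   is an edge in another triangle abc, then X_a + X_b = X_c and c takes the role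
   of x. Otherwise, after deleting the special vertices of degree 2, a vertex u
   of degree at most 2 is left, adjacent to one or two of the deleted vertices,
   and eliminating it contradicts the 2-tree statement for the edge joining the
   two remaining neighbours of u. Feasibility is only used when x is replaced
   by c or a pendant triangle is removed. *)

(** * Contractions and vertices of low degree *)

Section Graphs.
Variable T : finType.
Implicit Types (e : rel T) (A : {set T}).

Definition contract e (v p : T) : rel T :=
  [rel x y | [&& x != v, y != v, x != y &
    [|| e x y, (x == p) && e v y | (y == p) && e v x]]].

Definition nbrs e v : {set T} := [set w | e v w].
Definition arcs e : {set T * T} := [set a | e a.1 a.2].

Lemma contract_simple e v p : simple_graph e -> simple_graph (contract e v p).
Proof.
move=> [es ei]; rewrite /contract; split=> [x y|x] /=; last by rewrite eqxx /= !andbF.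
by rewrite andbCA eq_sym (es x y) [(y == p) && _ || _]orbC [y == x]eq_sym.
Qed.

Lemma K4_minor_free_sub e e' :
  subrel e' e -> K4_minor_free e -> K4_minor_free e'.
Proof.
move=> sub_e Ke [B [B0 Bd Bc Be]]; apply: Ke; exists B; split=> //.
- move=> i x y xB yB; apply: connect_sub (Bc i x y xB yB) => a b /and3P[/sub_e ab aB bB].
  by apply: connect1; rewrite /= ab aB.
- by move=> i j /Be [x [y [? ? /sub_e ?]]]; exists x, y.
Qed.

(** A model of the minor in the contraction lifts to [e] by adding [v] to the branch set that
    contains [p], if there is one. *)
Lemma contract_K4_minor_free e v p :
  simple_graph e -> e v p -> K4_minor_free e -> K4_minor_free (contract e v p).
Proof.
move=> [es ei] evp Ke [B [B0 Bd Bc Be]]; apply: Ke.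
(* [v] is isolated in the contraction, but its branch set would have to reach another one. *)
have vB i : v \notin B i.
  apply/negP => vi.
  pose j : 'I_4 := if i == ord0 then ord_max else ord0.
  have ij : i != j by rewrite /j; case: (i =P ord0) => [->|/eqP].
  have [x [y [xi yj]]] := Be i j ij; rewrite /= => /and4P[xv _ _ _].
  have /connectP[[|w s] /= ] := Bc i v x vi xi; first by move=> _ ex; rewrite ex eqxx in xv.
  by rewrite /contract /= eqxx.
pose B' i := if p \in B i then v |: B i else B i.
have BB' i : B i \subset B' i by rewrite /B'; case: ifP => // _; apply: subsetUr.
exists B'; split.
- move=> i; have /set0Pn[x xi] := B0 i; apply/set0Pn; exists x.
  exact: (subsetP (BB' i)).
- move=> i j ij; have dij := Bd i j ij; rewrite /B'.
  have dU k (C : {set T}) : v \notin C -> [disjoint B k & C] -> [disjoint v |: B k & C].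
    by move=> vC dC; rewrite disjoints_subset subUset -!disjoints_subset disjoints1 vC.
  case: ifP => pi; case: ifP => pj //.
  + by move/disjointFr: dij => /(_ _ pi); rewrite pj.
  + exact: dU.
  + by rewrite disjoint_sym; apply: dU => //; rewrite disjoint_sym.
- move=> i.
  pose r' : rel T := [rel a b | [&& e a b, a \in B' i & b \in B' i]].
  have rsym : connect_sym r'.
    by apply: sym_connect_sym => a b; rewrite /r' /= es [(a \in _) && _]andbC.
  (* An edge created by the contraction becomes a path of length two through [v]. *)
  have step a b : a \in B i -> b \in B i -> contract e v p a b -> connect r' a b.
    move=> ai bi /and4P[av bv ab /or3P[eab|/andP[/eqP ap evb]|/andP[/eqP bp eva]]].
    - by apply: connect1; rewrite /r' /= eab !(subsetP (BB' i)).
    - have pi : p \in B i by rewrite -ap.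
      have vi : v \in B' i by rewrite /B' pi setU11.
      apply: (@connect_trans _ _ v); apply: connect1; rewrite /r' /= ?evb ?vi ?(subsetP (BB' i)) //.
      by rewrite ap es evp.
    - have pi : p \in B i by rewrite -bp.
      have vi : v \in B' i by rewrite /B' pi setU11.
      apply: (@connect_trans _ _ v); apply: connect1; rewrite /r' /= ?evb ?vi ?(subsetP (BB' i)) //.
        by rewrite es eva.
      by rewrite bp evp.
  have old a b : a \in B i -> b \in B i -> connect r' a b.
    move=> ai bi; apply: connect_sub (Bc i a b ai bi) => a' b' /and3P[h a'i b'i].
    exact: step.
  have toB a : a \in B' i -> exists2 a', a' \in B i & connect r' a a'.
    rewrite /B'; case: ifP => pi; last by exists a.
    case/setU1P => [->|]; last by exists a.
    have vi : v \in B' i by rewrite /B' pi setU11.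
    by exists p => //; apply: connect1; rewrite /r' /= evp vi (subsetP (BB' i)).

  move=> x y /toB[x' x'i xx'] /toB[y' y'i yy'].
  apply: connect_trans xx' _; apply: connect_trans (old _ _ x'i y'i) _.
  by rewrite rsym.
- move=> i j ij; have [x [y [xi yj /and4P[xv yv xy]]]] := Be i j ij.
  case/or3P => [exy|/andP[/eqP xp evy]|/andP[/eqP yp evx]].
  + by exists x, y; split=> //; apply: (subsetP (BB' _)).
  + exists v, y; split=> //; last exact: (subsetP (BB' _)).
    by rewrite /B' -xp xi setU11.
  + exists x, v; split=> //; first exact: (subsetP (BB' _)); last by rewrite es.
    by rewrite /B' -yp yj setU11.
Qed.

Lemma clique_has_K4_minor e a b c d :
  simple_graph e -> e a b -> e a c -> e a d -> e b c -> e b d -> e c d ->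
  has_K4_minor e.
Proof.
move=> [es ei] ab ac ad bc bd cd.
have ne u w : e u w -> u != w by apply: contraTneq => ->; rewrite ei.
have nes u w : e u w -> w != u by rewrite es; apply: ne.
pose s := [:: a; b; c; d].
have Us : uniq s.
  by rewrite /s /= !inE !negb_or !(ne _ _ ab, ne _ _ ac, ne _ _ ad, ne _ _ bc, ne _ _ bd, ne _ _ cd).
exists (fun i : 'I_4 => [set nth a s i]); split.
- by move=> i; apply/set0Pn; exists (nth a s i); rewrite set11.
- move=> i j ij; rewrite disjoints1 inE nth_uniq //.
- by move=> i x y /set1P-> /set1P->; apply: connect0.
- move=> i j ij; exists (nth a s i), (nth a s j); rewrite !set11; split=> //.
  by move: i j ij => [[|[|[|[|i]]]] //= Hi] [[|[|[|[|j]]]] //= Hj] _ //; rewrite es.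
Qed.


(** Renaming [v] to [p] maps the arcs of [e] other than [(v, p)] onto a set that contains all arcs
    of the contraction. *)
Lemma arcs_contract_lt e v p :
  ssrbool.symmetric e -> e v p -> #|arcs (contract e v p)| < #|arcs e|.
Proof.
move=> es evp; rewrite (cardsD1 (v, p) (arcs e)) inE /= evp add1n ltnS.
pose g (a : T * T) := (if a.1 == v then p else a.1, if a.2 == v then p else a.2).
apply: leq_trans (leq_imset_card g _); apply: subset_leq_card.
apply/subsetP => -[x y]; rewrite inE /= => /and4P[xv yv xy].
case/or3P => [exy|/andP[/eqP xp evy]|/andP[/eqP yp evx]]; apply/imsetP.
- exists (x, y); last by rewrite /g /= (negPf xv) (negPf yv).
  by rewrite !inE /= exy xpair_eqE (negPf xv).
- exists (v, y); last by rewrite /g /= eqxx (negPf yv) xp.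
  by rewrite !inE /= evy xpair_eqE eqxx -xp eq_sym xy.
- exists (x, v); last by rewrite /g /= eqxx (negPf xv) yp.
  by rewrite !inE /= es evx xpair_eqE (negPf xv).
Qed.

Lemma contract_old e v p x y : irreflexive e ->
  e x y -> x != v -> y != v -> contract e v p x y.
Proof.
move=> ei exy xv yv; rewrite /contract /= xv yv exy andbT.
by apply: contraTneq exy => ->; rewrite ei.
Qed.

Lemma contract_new e v p y : irreflexive e ->
  e v p -> e v y -> y != p -> contract e v p p y.
Proof.
move=> ei evp evy yp; rewrite /contract /= eqxx evy orbT eq_sym [p == y]eq_sym yp !andbT.
by apply/andP; split; [apply: contraTneq evp | apply: contraTneq evy] => ->; rewrite ei.
Qed.

Lemma contract_isolated e v p x y : ssrbool.symmetric e -> e v p ->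
  contract e v p x y -> x != v /\ 0 < #|nbrs e x|.
Proof.
move=> es evp /and4P[xv _ _ h]; split=> //; apply/card_gt0P.
case/or3P: h => [exy|/andP[/eqP-> _]|/andP[_ evx]]; [exists y|exists v|exists v];
  by rewrite inE // es.
Qed.

(** The degree of a third vertex drops only if it sees both ends of the contracted edge, and then by
    at most one. *)
Lemma nbrs_contract_other e v p u : simple_graph e -> e v p -> u != v -> u != p ->
  0 < #|nbrs e u| ->
  #|nbrs e u| - (e v u && e u p) <= #|nbrs (contract e v p) u|.
Proof.
move=> [es ei] evp uv up; have sc := contract_simple v p (conj es ei).
case evu: (e v u) => /= _; last first.
  rewrite subn0; apply/subset_leq_card/subsetP => y; rewrite !inE => euy.
  apply: contract_old => //; apply: contraFneq evu => <-; by rewrite es.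
have sub : p |: (nbrs e u :\ v) \subset nbrs (contract e v p) u.
  apply/subsetP => y; rewrite !inE => /orP[/eqP->|/andP[yv euy]].
    by rewrite (sc.1); apply: contract_new.
  exact: contract_old.
apply: leq_trans (subset_leq_card sub); rewrite cardsU1 (cardsD1 v (nbrs e u)) !inE es evu.
have -> : (p != v) = true by apply: contraTneq evp => ->; rewrite ei.
by case: (e u p) => /=; clear; lia.
Qed.

Definition del_edge e a b : rel T :=
  [rel x y | e x y && ((x, y) \notin [:: (a, b); (b, a)])].

Lemma del_edge_simple e a b : simple_graph e -> simple_graph (del_edge e a b).
Proof.
move=> [es ei]; rewrite /del_edge; split=> [x y|x] /=; last by rewrite ei.
by rewrite es !inE !xpair_eqE orbC [(_ == b) && _]andbC [(y == b) && _]andbC.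
Qed.

(** The ends of a fixed edge are excluded because the 2-tree will be grown from that edge. *)
Definition low_vertex e b c v := [&& v != b, v != c & 0 < #|nbrs e v| <= 2].

Lemma card_setD2 A v q : #|A| <= (#|A :\ v :\ q|).+2.
Proof. by rewrite (cardsD1 v A) (cardsD1 q (A :\ v)); do 2 case: (_ \in _); lia. Qed.

(* Without a low vertex, delete an edge if all degrees outside {b, c} exceed 3.
   Otherwise let v have neighbours p, q, r: if they are not mutually adjacent,
   contracting an edge vp, and possibly q into p afterwards, keeps all degrees
   outside {b, c} at least 3. *)
Lemma ex_low_vertex e b c w : simple_graph e -> K4_minor_free e -> e b c ->
  w != b -> w != c -> 0 < #|nbrs e w| ->
  exists v, low_vertex e b c v.
Proof.
have [n] := ubnP #|arcs e|; elim: n => // n IHn in e w *; rewrite ltnS => len.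
move=> es Ke ebc wb wc w0; apply/existsP; apply: contraT => /existsPn nolow; exfalso.
have [sym irr] := es.
have ne x y : e x y -> x != y by apply: contraTneq => ->; rewrite irr.
have big u : u != b -> u != c -> 0 < #|nbrs e u| -> 2 < #|nbrs e u|.
  by move=> ub uc u0; have := nolow u; rewrite /low_vertex ub uc u0 /= -ltnNge.
(* A smaller graph that keeps the edge [bc], has a further non-isolated vertex and has no low vertex
   contradicts the induction hypothesis. *)
have small e' u : simple_graph e' -> K4_minor_free e' -> #|arcs e'| < #|arcs e| ->
    e' b c -> u != b -> u != c -> 0 < #|nbrs e' u| ->
    (forall x, x != b -> x != c -> 0 < #|nbrs e' x| -> 2 < #|nbrs e' x|) -> False.
  move=> se' Ke' lt' e'bc ub uc u0 big'.
  have [|v /and4P[vb vc v0]] := IHn e' u _ se' Ke' e'bc ub uc u0; first by apply: leq_trans lt' len.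
  by rewrite leqNgt big'.
have nbr0 x y : e x y -> 0 < #|nbrs e x| by move=> exy; apply/card_gt0P; exists y; rewrite inE.
(* This neighbour outside [{b, c}] is the non-isolated vertex that [small] asks for after a
   contraction at [v]. *)
have third v : #|nbrs e v| = 3 -> exists2 r, e v r & (r != b) && (r != c).
  move=> v3; have : ~~ (nbrs e v \subset [set b; c]).
    by apply/negP => /subset_leq_card; rewrite v3 cards2; case: (_ != _).
  by case/subsetPn => r; rewrite !inE negb_or => evr rbc; exists r.
have contr v p : #|nbrs e v| = 3 -> v != b -> v != c -> e v p ->
    (forall x, x != b -> x != c -> 0 < #|nbrs (contract e v p) x| ->
       2 < #|nbrs (contract e v p) x|) -> False.
  move=> v3 vb vc evp big'.
  have [sc ic] := contract_simple v p es.
  have [r evr /andP[rb rc]] := third v v3.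
  apply: (small (contract e v p) r) => //.
  - exact: contract_K4_minor_free.
  - exact: arcs_contract_lt.
  - by apply: contract_old; rewrite // eq_sym.
  - have [rp|rp] := eqVneq r p; last first.
      by apply/card_gt0P; exists p; rewrite inE sc; apply: contract_new.
    have : 0 < #|nbrs e v :\ p| by move: v3; rewrite (cardsD1 p) inE evp; clear; lia.
    case/card_gt0P => s; rewrite !inE => /andP[sp evs].
    by apply/card_gt0P; exists s; rewrite inE rp; apply: contract_new.
(* Every edge [vp] at a vertex of degree 3 lies in a triangle. Otherwise contracting it costs no
   other vertex a neighbour, while [p] trades [v] for the two other neighbours of [v]. *)
have common v p : #|nbrs e v| = 3 -> v != b -> v != c -> e v p ->
    exists q, e v q && e p q.
  move=> v3 vb vc evp; apply/existsP; apply: contraT => /existsPn nocom; exfalso.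
  apply: (contr v p v3 vb vc evp) => x xb xc /card_gt0P[y]; rewrite inE => /(contract_isolated sym evp)[xv x0].
  have xbig := big x xb xc x0.
  have [xp|xp] := eqVneq x p; last first.
    apply: leq_trans (nbrs_contract_other es evp xv xp x0).
    by have := nocom x; rewrite [e p x]sym; case: (e v x && _) => //; rewrite subn0.
  rewrite xp; have sub : (nbrs e p :\ v) :|: (nbrs e v :\ p) \subset nbrs (contract e v p) p.
    apply/subsetP => s; rewrite !inE => /orP[/andP[sv eps]|/andP[sp evs]].
      by apply: contract_old => //; rewrite eq_sym ne.
    exact: contract_new.
  apply: leq_trans (subset_leq_card sub); rewrite cardsU.
  have -> : (nbrs e p :\ v) :&: (nbrs e v :\ p) = set0.
    apply/setP => s; rewrite !inE; have := nocom s; case: (e v s); case: (e p s) => //=;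
    by rewrite ?andbF.
  move: xbig v3; rewrite xp (cardsD1 v (nbrs e p)) (cardsD1 p (nbrs e v)) cards0 !inE [e p v]sym evp.
  by clear; lia.
(* The neighbours of [v] cannot induce a path [pqr]. *)
have fan v p q r : nbrs e v = [set p; q; r] -> #|nbrs e v| = 3 -> v != b -> v != c ->
    e p q -> e q r -> ~~ e p r -> False.
  move=> Nv v3 vb vc epq eqr npr.
  have evp : e v p by have : p \in nbrs e v; [rewrite Nv !inE eqxx|rewrite inE].
  have evq : e v q by have : q \in nbrs e v; [rewrite Nv !inE eqxx orbT|rewrite inE].
  have evr : e v r by have : r \in nbrs e v; [rewrite Nv !inE eqxx orbT|rewrite inE].
  have pr : p != r.
    apply: contraTneq isT => Epr; move: v3; rewrite Nv Epr.
    by rewrite -setUA setUC -setUA setUid cards2; case: (_ != _).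
  (* Contracting [vp] lowers only the degree of [q], since [p] loses [v] but gains [r]. This is
     harmless unless [q] is a vertex of degree exactly 3 outside [{b, c}]. *)
  have [/and3P[qb qc q3]|qbig] := boolP [&& (q != b), (q != c) & #|nbrs e q| == 3]; last first.
    apply: (contr v p v3 vb vc evp) => x xb xc /card_gt0P[y]; rewrite inE => /(contract_isolated sym evp)[xv x0].
  have xbig := big x xb xc x0.
    have [xp|xp] := eqVneq x p; last first.
      apply: leq_trans (nbrs_contract_other es evp xv xp x0).
      case: (boolP (_ && _)) => [/andP[evx exp]|_]; last by rewrite subn0.
      have : x \in nbrs e v by rewrite inE.
      rewrite Nv !inE (negPf xp) /= => /orP[/eqP xq|/eqP xr]; last by rewrite -xr sym exp in npr.
      by move: qbig xbig; rewrite -xq xb xc /=; clear; lia.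
    rewrite xp; apply: (@leq_trans #|r |: (nbrs e p :\ v)|).
      by rewrite cardsU1 !inE (negPf npr) andbF; move: xbig; rewrite xp (cardsD1 v) inE sym evp.
    apply/subset_leq_card/subsetP => s; rewrite !inE => /orP[/eqP->|/andP[sv eps]].
      by apply: contract_new; rewrite // eq_sym.
    by apply: contract_old => //; rewrite eq_sym ne.
  have Nq : nbrs e q = [set v; p; r].
    apply/esym/eqP; rewrite eqEcard (eqP q3); apply/andP; split.
      by apply/subsetP => s; rewrite !inE => /orP[/orP[]|] /eqP->; rewrite // sym.
    by rewrite -setUA cardsU1 cards2 pr !inE !negb_or ne ?ne.
  (* If [s] had only one neighbour [s'] besides [v] and [q], the edge [ss'] would lie in a triangle,
     so [s'] would be adjacent to [v] or [q]. That forces [s'] to be [t], which is not adjacent to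
     [s]. *)
  have end4 s t : e v s -> e q s -> ~~ e s t -> e v t -> e q t -> s != b -> s != c ->
      (forall x, e v x -> [|| x == s, x == t | x == q]) ->
      (forall x, e q x -> [|| x == s, x == t | x == v]) -> 3 < #|nbrs e s|.
    move=> evs eqs nst evt eqt sb sc Nv' Nq'.
    have s3 := big s sb sc; rewrite ltn_neqAle s3 ?(nbr0 _ v) // ?andbT; last by rewrite sym.
    apply/eqP => /esym s3'.
    have : 0 < #|nbrs e s :\ v :\ q|.
      move: s3'; rewrite (cardsD1 v) (cardsD1 q) !inE [e s v]sym evs [e s q]sym eqs.
      by rewrite [q == v]eq_sym (ne _ _ evq) /=; clear; lia.
    case/card_gt0P => s'; rewrite !inE => /and3P[s'q s'v ess'].
    have [u /andP[esu es'u]] := common s s' s3' sb sc ess'.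
    have Ns : nbrs e s = [set v; q; s'].
      apply/esym/eqP; rewrite eqEcard s3'; apply/andP; split.
        by apply/subsetP => x; rewrite !inE => /orP[/orP[]|] /eqP->; rewrite // sym.
      by rewrite -setUA cardsU1 cards2 [q == _]eq_sym s'q !inE !negb_or (ne _ _ evq) eq_sym s'v.
    have : u \in nbrs e s by rewrite inE.
    rewrite Ns !inE => /orP[/orP[]|] /eqP Eu; move: es'u; rewrite Eu ?irr // sym.
      case/Nv'/or3P => /eqP E; last by rewrite E eqxx in s'q.
        by move: ess'; rewrite E irr.
      by rewrite -E ess' in nst.
    case/Nq'/or3P => /eqP E; last by rewrite E eqxx in s'v.
      by move: ess'; rewrite E irr.
    by rewrite -E ess' in nst.
  have Nv' x : e v x -> [|| x == p, x == q | x == r].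
    by move=> evx; have : x \in nbrs e v by [rewrite inE]; rewrite Nv !inE -orbA.
  have Nq' x : e q x -> [|| x == v, x == p | x == r].
    by move=> eqx; have : x \in nbrs e q by [rewrite inE]; rewrite Nq !inE -orbA.
  have eqp : e q p by rewrite sym.
  have p4 : p != b -> p != c -> 3 < #|nbrs e p|.
    move=> pb pc; apply: (end4 p r) => // x.
      by move/Nv'; case/or3P => ->; rewrite ?orbT.
    by move/Nq'; case/or3P => ->; rewrite ?orbT.
  have r4 : r != b -> r != c -> 3 < #|nbrs e r|.
    move=> rb rc; apply: (end4 r p) => //; first by rewrite sym.
      by move=> x /Nv'; case/or3P => ->; rewrite ?orbT.
    by move=> x /Nq'; case/or3P => ->; rewrite ?orbT.
  (* Merging both [v] and [q] into [p] creates the edge [pr]. Each of [p] and [r] loses two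
     neighbours and gains one, which degree at least 4 allows. *)
  pose e1 := contract e v p; pose e2 := contract e1 q p.
  have s1 : simple_graph e1 := contract_simple v p es.
  have s2 : simple_graph e2 := contract_simple q p s1.
  have e1qp : e1 q p by rewrite s1.1; apply: contract_new => //; rewrite eq_sym ne.
  have e1qr : e1 q r.
    by apply: contract_old => //; rewrite eq_sym ne.
  have old x y : e x y -> x != v -> y != v -> x != q -> y != q -> e2 x y.
    by move=> exy xv yv xq yq; apply: contract_old s1.2 _ xq yq; apply: contract_old.
  have e2pr : e2 p r by apply: contract_new s1.2 _ _ _ => //; rewrite eq_sym.
  have [u ur /andP[ub uc]] : exists2 u, (u == p) || (u == r) & (u != b) && (u != c).
    have [/andP[pb pc]|np] := boolP ((p != b) && (p != c)).
      by exists p; rewrite ?eqxx // pb.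
    exists r; rewrite ?eqxx ?orbT // -negb_or; apply: contra npr.
    move: np; rewrite -negb_or negbK => /orP[]/eqP pE /orP[] /eqP rE; move: pr; rewrite pE rE ?eqxx // => _.
    by rewrite sym.
  apply: (small e2 u) => //.
  - by apply: contract_K4_minor_free => //; apply: contract_K4_minor_free.
  - by apply: ltn_trans (arcs_contract_lt sym evp); apply: (arcs_contract_lt s1.1).
  - by apply: old => //; rewrite eq_sym.
  - apply/card_gt0P; case/orP: ur => /eqP->; first by exists r; rewrite inE.
    by exists p; rewrite inE s2.1.
  move=> x xb xc /card_gt0P[y]; rewrite inE => e2xy.
  have [xq /card_gt0P[y']] := contract_isolated s1.1 e1qp e2xy.
  rewrite inE => /(contract_isolated sym evp)[xv x0].
  have e2old : nbrs e x :\ v :\ q \subset nbrs e2 x.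
    by apply/subsetP => s; rewrite !inE => /and3P[sq sv exs]; apply: old.
  have [xp|xp] := eqVneq x p.
    have := p4; rewrite -xp => /(_ xb xc) x4.
    apply: (@leq_trans #|r |: (nbrs e x :\ v :\ q)|).
      rewrite cardsU1 !inE xp (negPf npr) !andbF /=.
      by have := card_setD2 (nbrs e p) v q; move: x4; rewrite xp; clear; lia.
    apply/subset_leq_card; rewrite subUset e2old andbT.
    by apply/subsetP => s /set1P->; rewrite inE xp.
  have [xr|xr] := eqVneq x r.
    have := r4; rewrite -xr => /(_ xb xc) x4.
    apply: (@leq_trans #|p |: (nbrs e x :\ v :\ q)|).
      rewrite cardsU1 !inE xr [e r p]sym (negPf npr) !andbF /=.
      by have := card_setD2 (nbrs e r) v q; move: x4; rewrite xr; clear; lia.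
    apply/subset_leq_card; rewrite subUset e2old andbT.
    by apply/subsetP => s /set1P->; rewrite inE xr s2.1.
  have xbig := big x xb xc x0; apply: leq_trans xbig _.
  apply/subset_leq_card/subsetP => s sx; apply: (subsetP e2old).
  move: (sx); rewrite !inE => exs; rewrite exs andbT; apply/andP; split.
    apply: contraTneq exs => ->; rewrite sym; apply/negP => /Nq'.
    by rewrite (negPf xp) (negPf xr) (negPf xv).
  apply: contraTneq exs => ->; rewrite sym; apply/negP => /Nv'.
  by rewrite (negPf xp) (negPf xr) (negPf xq).
(* By [common], the three neighbours of a vertex of degree 3 induce a triangle, giving a [K_4], or a
   path, excluded by [fan]. *)
have [/existsP[v /and3P[vb vc /eqP v3]]|no3] := boolP [exists v, [&& v != b, v != c & #|nbrs e v| == 3]].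
  have [p evp] : exists p, e v p.
    by have /card_gt0P[p] : 0 < #|nbrs e v| by [rewrite v3]; rewrite inE; exists p.
  have [q /andP[evq epq]] := common v p v3 vb vc evp.
  have : 0 < #|nbrs e v :\ p :\ q|.
    by move: v3; rewrite (cardsD1 p) (cardsD1 q) !inE evp evq; case: (_ != _) => /=; clear; lia.
  case/card_gt0P => r; rewrite !inE => /and3P[rq rp evr].
  have Nv : nbrs e v = [set p; q; r].
    apply/esym/eqP; rewrite eqEcard v3; apply/andP; split.
      by apply/subsetP => s; rewrite !inE => /orP[/orP[]|] /eqP->.
    by rewrite -setUA cardsU1 cards2 [q == _]eq_sym rq !inE !negb_or (ne _ _ epq) eq_sym rp.
  have [s /andP[evs ers]] := common v r v3 vb vc evr.
  have : s \in nbrs e v by rewrite inE.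
  have [epr|npr] := boolP (e p r); have [eqr|nqr] := boolP (e q r).
  - by move=> _; apply: Ke; apply: (@clique_has_K4_minor e v p q r).
  - move=> _; apply: (fan v q p r) => //; last by rewrite sym.
    by rewrite Nv [[set p; q]]setUC.
  - by move=> _; apply: (fan v p q r).
  - rewrite Nv !inE => /orP[/orP[]|] /eqP E; move: ers; rewrite E ?irr // sym.
      by rewrite (negPf npr).
    by rewrite (negPf nqr).
have big4 u : u != b -> u != c -> 0 < #|nbrs e u| -> 3 < #|nbrs e u|.
  move=> ub uc u0; rewrite ltn_neqAle big // andbT eq_sym.
  by apply: contra no3 => u3; apply/existsP; exists u; rewrite ub uc.
(* All degrees outside [{b, c}] are now at least 4, so an edge at [w] can be deleted. *)
have /card_gt0P[z] := w0; rewrite inE => ewz.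
have ned (x y : T) : x != w -> y != w -> (x, y) \notin [:: (w, z); (z, w)].
  by move=> xw yw; rewrite !inE !xpair_eqE (negPf xw) (negPf yw) andbF.
have degd x : #|nbrs e x| <= (#|nbrs (del_edge e w z) x|).+1.
  pose t := if x == w then z else w.
  apply: leq_trans (_ : #|t |: nbrs (del_edge e w z) x| <= _); last by rewrite cardsU1; case: (_ \notin _).
  apply/subset_leq_card/subsetP => y; rewrite !inE => exy.
  rewrite /del_edge /= exy !inE !xpair_eqE /t; have [xw|xw] /= := eqVneq x w.
    by have [//|yz] := eqVneq y z; rewrite /= xw; move: (ne _ _ ewz); rewrite eq_sym; case: eqP.
  by case: (y == w); rewrite ?orbT ?andbF.
apply: (small (del_edge e w z) w) => //.
- exact: del_edge_simple.
- by apply: K4_minor_free_sub Ke => x y /andP[].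
- apply: proper_card; apply/properP; split.
    by apply/subsetP => a; rewrite !inE => /andP[].
  exists (w, z); first by rewrite inE.
  by rewrite inE /del_edge /= !inE eqxx andbF.
- by rewrite /del_edge /= ebc ned // eq_sym.
- by have := big4 w wb wc w0; have := degd w; clear; lia.
- move=> x xb xc /card_gt0P[y]; rewrite inE => /andP[exy _].
  by have := big4 x xb xc (nbr0 _ _ exy); have := degd x; clear; lia.
Qed.


(** [ex_low_vertex] is applied to an edge [df] with [d = r], or to [ab] when [r] is isolated. If no
    other vertex has a neighbour, [f] itself has degree 1. *)
Lemma ex_low_vertex_away e r a b : simple_graph e -> K4_minor_free e -> e a b ->
  exists2 v, v != r & 0 < #|nbrs e v| <= 2.
Proof.
move=> es Ke eab; have [sym irr] := es.
have nbr0 x y : e x y -> 0 < #|nbrs e x| by move=> exy; apply/card_gt0P; exists y; rewrite inE.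
have [d [f [edf rdf]]] : exists d f, e d f /\ (r == d) || (#|nbrs e r| == 0).
  case: (posnP #|nbrs e r|) => [r0 | /card_gt0P[w]]; first by exists a, b; rewrite ?r0 ?eqxx orbT.
  by rewrite inE => erw; exists r, w; rewrite eqxx.
have nr v : 0 < #|nbrs e v| -> v != d -> v != r.
  move=> v0 vd; case/orP: rdf => [/eqP-> //|/eqP r0].
  by apply: contraTneq v0 => ->; rewrite r0.
case: (pickP (fun w => [&& w != d, w != f & 0 < #|nbrs e w|])) => [w /and3P[wd wf w0]|none].
  have [v /and4P[vd vf v0 v2]] := ex_low_vertex es Ke edf wd wf w0.
  by exists v; [apply: nr | rewrite v0].
have f0 : 0 < #|nbrs e f| by apply: (nbr0 f d); rewrite sym.
exists f; first by apply: nr => //; apply: contraTneq edf => ->; rewrite irr.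
rewrite f0; apply: (@leq_trans #|[set d]|); last by rewrite cards1.
apply/subset_leq_card/subsetP => w.
rewrite !inE => efw; have := none w; have w0 : 0 < #|nbrs e w| by apply: (nbr0 w f); rewrite sym.
rewrite w0 andbT; have -> : w != f by apply: contraTneq efw => ->; rewrite irr.
by case: (w == d).
Qed.

Definition delv e x : rel T := [rel u v | [&& e u v, u != x & v != x]].

Definition add_edge e a b : rel T :=
  [rel x y | e x y || ((x, y) \in [:: (a, b); (b, a)])].

Lemma delv_simple e x : simple_graph e -> simple_graph (delv e x).
Proof.
by move=> [es ei]; split=> [u v|u]; rewrite /delv /= ?ei // es [(u != x) && _]andbC.
Qed.

Lemma delv_K4_minor_free e x : K4_minor_free e -> K4_minor_free (delv e x).
Proof. by apply: K4_minor_free_sub => u v /and3P[]. Qed.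

Lemma add_edge_simple e a b : simple_graph e -> a != b -> simple_graph (add_edge e a b).
Proof.
move=> [es ei] ab; rewrite /add_edge; split=> [u v|u] /=.
  by rewrite es !inE !xpair_eqE orbC [in RHS]orbC; congr (_ || _); rewrite orbC [(v == _) && _]andbC [(v == _) && _]andbC.
rewrite ei !inE !xpair_eqE /=; have [->|] //= := eqVneq u a; last by rewrite andbF.
by rewrite (negPf ab).
Qed.

(** The new graph is a subgraph of the contraction of [v] into [a]. *)
Lemma bypass_K4_minor_free e v a b : simple_graph e -> K4_minor_free e ->
  e v a -> e v b -> a != b -> K4_minor_free (add_edge (delv e v) a b).
Proof.
move=> es Ke eva evb ab; have [sym irr] := es.
have sc := contract_simple v a es.
apply: K4_minor_free_sub (contract_K4_minor_free es eva Ke) => x y.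
have cab : contract e v a a b by apply: contract_new; rewrite // eq_sym.
case/orP => [/and3P[exy xv yv]|]; first exact: contract_old.
by rewrite !inE !xpair_eqE => /orP[] /andP[/eqP-> /eqP->]; rewrite // sc.1.
Qed.

End Graphs.

Local Open Scope ring_scope.

(** * The ideal of cubes and the graph polynomial over F_2 *)

Section Ideal.
Variable n : nat.
Local Notation R := {mpoly 'F_2[n]}.
Implicit Types (F G : R) (i j : 'I_n).

Lemma mpoly2_addxx F : F + F = 0.
Proof.
rewrite -mulr2n; apply/mpolyP => m; rewrite mcoeffMn mcoeff0 mulr2n.
by case: (F@_m) => -[|[|//]] Hx; apply/val_inj.
Qed.

(** The ideal generated by the cubes of the variables is monomial, so membership can be read off
    from the support. *)
Definition in_cubes F := all (fun m : 'X_{1..n} => [exists i, 2 < m i]%N) (msupp F).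

Definition free_of i F := all (fun m : 'X_{1..n} => m i == 0%N) (msupp F).

Lemma in_cubesP F :
  reflect (forall m, F@_m != 0 -> exists i, (2 < m i)%N) (in_cubes F).
Proof.
apply: (iffP allP) => H m.
  by rewrite -mcoeff_msupp => /H/existsP.
by rewrite mcoeff_msupp => /H ?; apply/existsP.
Qed.

Lemma free_ofP i F :
  reflect (forall m, F@_m != 0 -> m i = 0%N) (free_of i F).
Proof.
apply: (iffP allP) => H m.
  by rewrite -mcoeff_msupp => /H/eqP.
by rewrite mcoeff_msupp => /H ->.
Qed.

Lemma in_cubesD F G : in_cubes F -> in_cubes G -> in_cubes (F + G).
Proof.
move=> /allP HF /allP HG; apply/allP => m /msuppD_le; rewrite mem_cat.
by case/orP => [/HF|/HG].
Qed.

(** Makes [ring] usable in characteristic 2: the terms that cancel are collected in the explicit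
    argument [H]. *)
Lemma in_cubes_mod2 F G H : F = G + (H + H) -> in_cubes F -> in_cubes G.
Proof. by move=> ->; rewrite mpoly2_addxx addr0. Qed.

Lemma in_cubesMr F G : in_cubes F -> in_cubes (F * G).
Proof.
move=> /allP HF; apply/allP => m /msuppM_le /allpairsP[[m1 m2] /= [/HF/existsP[i m1i] _ ->]].
by apply/existsP; exists i; rewrite mnmDE; apply: leq_trans m1i (leq_addr _ _).
Qed.

Lemma in_cubesMl F G : in_cubes F -> in_cubes (G * F).
Proof. by rewrite mulrC; apply: in_cubesMr. Qed.

Lemma in_cubes0 : in_cubes 0.
Proof. by rewrite /in_cubes msupp0. Qed.

Lemma in_cubes1 : ~~ in_cubes 1.
Proof.
apply/negP => /in_cubesP/(_ 0%MM); rewrite mcoeff1 eqxx oner_eq0 => -[//|i].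
by rewrite mnm0E.
Qed.

Lemma in_cubesX3 i : in_cubes ('X_i ^+ 3).
Proof.
apply/in_cubesP => m; rewrite mcoeffXn; case: (_ =P m) => [<- _|_ /eqP//].
by exists i; rewrite mulmnE mnm1E eqxx.
Qed.

Lemma free_ofD i F G : free_of i F -> free_of i G -> free_of i (F + G).
Proof.
move=> /allP HF /allP HG; apply/allP => m /msuppD_le; rewrite mem_cat.
by case/orP => [/HF|/HG].
Qed.

Lemma free_ofM i F G : free_of i F -> free_of i G -> free_of i (F * G).
Proof.
move=> /allP HF /allP HG; apply/allP => m /msuppM_le /allpairsP[[m1 m2] /= [/HF/eqP m1i /HG/eqP m2i ->]].
by rewrite mnmDE m1i m2i.
Qed.

Lemma free_of0 i : free_of i 0.
Proof. by rewrite /free_of msupp0. Qed.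

Lemma free_of1 i : free_of i 1.
Proof.
by apply/free_ofP => m; rewrite mcoeff1; case: (m =P _) => [-> _|_ /eqP//]; rewrite mnm0E.
Qed.

Lemma free_ofX i j : j != i -> free_of i 'X_j.
Proof.
move=> ji; apply/free_ofP => m; rewrite mcoeffX; case: (_ =P m) => [<- _|_ /eqP//].
by rewrite mnm1E (negPf ji).
Qed.

(** A monomial [m] of [F2] occurs in [F] multiplied by the square of [X_i], apart from the cube
    term. Some exponent there exceeds 2; it is not that of [X_i], which is exactly 2, hence it
    belongs to [m]. *)
Lemma in_cubes_elim i F0 F1 F2 F G :
  free_of i F0 -> free_of i F1 -> free_of i F2 ->
  F = F0 + F1 * 'X_i + F2 * 'X_i ^+ 2 + G * 'X_i ^+ 3 ->
  in_cubes F -> in_cubes F2.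
Proof.
move=> f0 f1 f2 -> H.
have {H} H : in_cubes (F0 + F1 * 'X_i + F2 * 'X_i ^+ 2).
  have := in_cubesD H (in_cubesMl G (in_cubesX3 i)).
  by rewrite -addrA mpoly2_addxx addr0.
apply/in_cubesP => m Fm; have mi : m i = 0%N := free_ofP _ _ f2 m Fm.
have [|j] := in_cubesP _ H (U_(i) + U_(i) + m)%MM.
  have F0m : F0@_(U_(i) + U_(i) + m)%MM = 0.
    by apply: contraTeq isT => /(free_ofP _ _ f0); rewrite !mnmDE mnm1E eqxx.
  have F1m : F1@_(U_(i) + m)%MM = 0.
    by apply: contraTeq isT => /(free_ofP _ _ f1); rewrite !mnmDE mnm1E eqxx.
  rewrite !mcoeffD F0m add0r -{1}addmA mcoeffMX F1m add0r.
  by rewrite expr2 -mpolyXD mcoeffMX.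
rewrite !mnmDE !mnm1E; have [<-|ij] := eqVneq i j; first by rewrite mi.
by exists j.
Qed.
End Ideal.

(** * The graph polynomial and its relations modulo cubes *)

Section GraphPoly.
Variable T : finType.
Implicit Types (e d : rel T) (A : {set T}).
Local Notation R := {mpoly 'F_2[#|T|]}.
Implicit Types (Q : R).

Definition X (v : T) : R := 'X_(enum_rank v).

Definition arcs_poly d : R := \prod_(a : T * T | d a.1 a.2) (X a.1 + X a.2).

(** Orients each edge by the enumeration of [T], so that an edge contributes a single factor to the
    product. *)
Definition ranked e : rel T := [rel u v | e u v && (enum_rank u < enum_rank v)%N].

Definition graph_poly e : R := arcs_poly (ranked e).

Definition var_free v Q := free_of (enum_rank v) Q.

Lemma eq_graph_poly e e' : e =2 e' -> graph_poly e = graph_poly e'.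
Proof. by move=> ee'; apply: eq_bigl => a; rewrite /ranked /= ee'. Qed.

Lemma rank_neq (u v : T) : u != v -> (enum_rank u < enum_rank v)%N = ~~ (enum_rank v < enum_rank u)%N.
Proof.
move=> uv; case: (ltngtP (enum_rank u) (enum_rank v)) => // /val_inj/enum_rank_inj E.
by rewrite E eqxx in uv.
Qed.

(** The factor of an edge is symmetric over F_2, so arcs running against the ranking can be turned
    around. *)
Lemma arcs_poly_orientation e d : simple_graph e -> orientation e d ->
  arcs_poly d = graph_poly e.
Proof.
move=> [es ei] [de dd]; rewrite /graph_poly /arcs_poly /ranked /=.
rewrite (bigID (fun a : T * T => (enum_rank a.1 < enum_rank a.2)%N)) /=.
rewrite [RHS](bigID (fun a : T * T => d a.1 a.2)) /=; congr (_ * _).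
  apply: eq_bigl => -[u v] /=; case duv: (d u v); rewrite ?andbF // andbT.
  by rewrite de.
pose sw (a : T * T) := (a.2, a.1).
rewrite (reindex_inj (h := sw)) /=; last by move=> [a b] [c f] [-> ->].
apply: eq_big => [[u v] /=|[u v] _ /=]; last by rewrite addrC.
case euv: (e u v); last by apply/negbTE; rewrite negb_and; apply/orP; left; apply: contraFN euv => /de; rewrite es.
have uv : u != v by apply: contraTneq euv => ->; rewrite ei.
rewrite [in LHS]rank_neq 1?eq_sym // negbK andbC /=; congr (_ && _).
by have := dd _ _ euv; case: (d u v); case: (d v u).
Qed.

Lemma graph_poly_del_edge e a b : simple_graph e -> e a b ->
  graph_poly e = (X a + X b) * graph_poly (del_edge e a b).
Proof.
move=> es eab; wlog ab : a b eab / (enum_rank a < enum_rank b)%N => [hw|].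
  have abn : a != b by apply: contraTneq eab => ->; rewrite es.2.
  have [|ba] := boolP (enum_rank a < enum_rank b)%N; first exact: hw.
  rewrite addrC (hw b a); [|by rewrite es.1|by rewrite rank_neq // eq_sym].
  congr (_ * _); apply: eq_graph_poly => u v.
  by rewrite /del_edge /= !inE [X in ~~ X]orbC.
rewrite /graph_poly /arcs_poly /ranked /= (bigD1 (a, b)) /= ?eab //; congr (_ * _).
apply: eq_bigl => -[u v]; rewrite /del_edge /= !inE negb_or; case: (e u v) => //=.
have [uv|] := boolP (enum_rank u < enum_rank v)%N; rewrite ?andbF //= !andbT.
have -> : ((u, v) != (b, a)); rewrite ?andbT //.
by apply: contraTneq uv => -[-> ->]; rewrite -leqNgt ltnW.
Qed.

Lemma graph_poly_add_edge e a b : simple_graph e -> a != b -> ~~ e a b ->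
  graph_poly (add_edge e a b) = (X a + X b) * graph_poly e.
Proof.
move=> es ab nab; have sa := add_edge_simple es ab.
rewrite (graph_poly_del_edge sa (a := a) (b := b)); last by rewrite /add_edge /= mem_head orbT.
congr (_ * _); apply: eq_graph_poly => u v; rewrite /del_edge /add_edge /=.
have [|_] := boolP ((u, v) \in _); last by rewrite orbF andbT.
by rewrite andbF !inE !xpair_eqE => /orP[] /andP[/eqP-> /eqP->]; rewrite ?[e b a]es.1 (negPf nab).
Qed.

Lemma graph_poly_leaf e v a : simple_graph e -> nbrs e v = [set a] ->
  graph_poly e = (X v + X a) * graph_poly (delv e v).
Proof.
move=> es Nv; have Nv' w : e v w = (w == a) by move/setP/(_ w): Nv; rewrite !inE.
rewrite (graph_poly_del_edge es (a := v) (b := a)) ?Nv' //; congr (_ * _).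
apply: eq_graph_poly => u w; rewrite /del_edge /delv /= !inE !xpair_eqE negb_or.
have [->|uv] := eqVneq u v; first by rewrite Nv' /=; case: (w == a); rewrite ?andbF.
have [->|wv] /= := eqVneq w v; last by rewrite andbF.
by rewrite es.1 Nv' andbT; case: (u == a).
Qed.

Lemma graph_poly_deg2 e v a b : simple_graph e -> a != b -> nbrs e v = [set a; b] ->
  graph_poly e = (X v + X a) * (X v + X b) * graph_poly (delv e v).
Proof.
move=> es ab Nv; have Nv' w : e v w = (w == a) || (w == b) by move/setP/(_ w): Nv; rewrite !inE.
rewrite (graph_poly_del_edge es (a := v) (b := a)) ?Nv' ?eqxx // -mulrA; congr (_ * _).
have sd := del_edge_simple v a es.
have va : v != a by apply/eqP => E; have := Nv' v; rewrite es.2 E eqxx.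
rewrite (graph_poly_leaf sd (v := v) (a := b)).
  congr (_ * _); apply: eq_graph_poly => u w; rewrite /del_edge /delv /= !inE !xpair_eqE.
  have [->|uv] := eqVneq u v; first by rewrite !andbF.
  by have [->|wv] := eqVneq w v; rewrite ?andbF ?andbT.
apply/setP => w; rewrite !inE /del_edge /= Nv' !inE !xpair_eqE eqxx (negPf va) /= orbF.
have [->|] := eqVneq w a; last by rewrite andbT.
by rewrite (negPf ab).
Qed.

Lemma graph_poly_sub e e' : subrel e e' -> exists Q, graph_poly e' = graph_poly e * Q.
Proof.
move=> sub; rewrite /graph_poly /arcs_poly.
rewrite [X in exists _, X = _](bigID (fun a : T * T => e a.1 a.2)) /=.
exists (\prod_(a : T * T | ranked e' a.1 a.2 && ~~ e a.1 a.2) (X a.1 + X a.2)).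
congr (_ * _); apply: eq_bigl => a /=; rewrite andbAC; congr (_ && _).
by case eab: (e a.1 a.2); rewrite ?andbF // sub.
Qed.

Lemma freeX u v : u != v -> var_free v (X u).
Proof. by move=> uv; apply: free_ofX; rewrite (inj_eq enum_rank_inj). Qed.

Lemma free_graph_poly e v : simple_graph e -> (forall w, ~~ e v w) -> var_free v (graph_poly e).
Proof.
move=> es ev; apply: (big_ind (var_free v)); [exact: free_of1|move=> ? ?; exact: free_ofM|].
move=> [a b] /= /andP[eab _]; apply: free_ofD; apply: freeX; apply: contraTneq eab => ->.
  exact: ev.
by rewrite es.1; apply: ev.
Qed.

Lemma free_delv e v : simple_graph e -> var_free v (graph_poly (delv e v)).
Proof.
move=> es; apply: free_graph_poly; first exact: delv_simple.
by move=> w; rewrite /delv /= eqxx andbF.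
Qed.

(** The coefficient of the square of [X_v] is extracted. If [v] has degree 1, the polynomial is
    first multiplied by [X_v]. *)
Lemma in_cubes_delv e v Q : simple_graph e -> (0 < #|nbrs e v| <= 2)%N -> var_free v Q ->
  in_cubes (Q * graph_poly e) -> in_cubes (Q * graph_poly (delv e v)).
Proof.
move=> es /andP[v0 v2] fQ H; have fd := free_delv v es.
have fQd := free_ofM fQ fd.
have irr w : e v w -> w != v by apply: contraTneq => ->; rewrite es.2.
have [/cards1P[a Nv]|v1] := boolP (#|nbrs e v| == 1)%N.
  have va : a != v by apply: irr; have : a \in nbrs e v; [rewrite Nv set11|rewrite inE].
  rewrite (graph_poly_leaf es Nv) in H.
  apply: (in_cubes_elim (i := enum_rank v) (F0 := 0) (F1 := Q * graph_poly (delv e v) * X a)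
     (G := 0) _ _ _ _ (in_cubesMl (X v) H)) => //.
  - exact: free_of0.
  - by apply: free_ofM => //; apply: freeX.
  - rewrite -/(X v); ring.
have /cards2P[a [b [ab Nv]]] : (#|nbrs e v| == 2)%N by rewrite eqn_leq v2 ltn_neqAle eq_sym v1.
have va : a != v by apply: irr; have : a \in nbrs e v; [rewrite Nv !inE eqxx|rewrite inE].
have vb : b != v by apply: irr; have : b \in nbrs e v; [rewrite Nv !inE eqxx orbT|rewrite inE].
rewrite (graph_poly_deg2 es ab Nv) in H.
apply: (in_cubes_elim (i := enum_rank v) (F0 := Q * graph_poly (delv e v) * (X a * X b))
    (F1 := Q * graph_poly (delv e v) * (X a + X b)) (G := 0) _ _ _ _ H) => //.
- by apply: free_ofM => //; apply: free_ofM; apply: freeX.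
- by apply: free_ofM => //; apply: free_ofD; apply: freeX.
- rewrite -/(X v); ring.
Qed.

(** Over F_2, (a + b + c)(a + b)(b + c)(a + c) = a^3(b + c) + b^3(a + c) + c^3(a + b). *)
Lemma triangle_relation e a b c : simple_graph e -> e a b -> e b c -> e a c ->
  in_cubes ((X a + X b + X c) * graph_poly e).
Proof.
move=> es eab ebc eac.
have ne x y : e x y -> x != y by apply: contraTneq => ->; rewrite es.2.
have s1 := del_edge_simple a b es; have s2 := del_edge_simple b c s1.
have [ab bc ac] := And3 (ne _ _ eab) (ne _ _ ebc) (ne _ _ eac).
rewrite (graph_poly_del_edge es eab) (graph_poly_del_edge s1 (a := b) (b := c)); last first.
  by rewrite /del_edge /= ebc !inE !xpair_eqE [b == a]eq_sym (negPf ab) [c == a]eq_sym (negPf ac) andbF.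
rewrite (graph_poly_del_edge s2 (a := a) (b := c)); last first.
  by rewrite /del_edge /= eac !inE !xpair_eqE eqxx [c == b]eq_sym (negPf bc) (negPf ac) (negPf ab) ?andbF.
set P := graph_poly _.
have -> : (X a + X b + X c) * ((X a + X b) * ((X b + X c) * ((X a + X c) * P)))
  = X a ^+ 3 * ((X b + X c) * P) + X b ^+ 3 * ((X a + X c) * P) + X c ^+ 3 * ((X a + X b) * P)
   + (((X a * X b) ^+2 + (X b * X c) ^+2 + (X a * X c) ^+ 2 + 2%:R * (X a * X b * X c) * (X a + X b + X c)) * P
    + ((X a * X b) ^+2 + (X b * X c) ^+2 + (X a * X c) ^+ 2 + 2%:R * (X a * X b * X c) * (X a + X b + X c)) * P).
  ring.
by rewrite mpoly2_addxx addr0; do 2 ?apply: in_cubesD; apply: in_cubesMr; apply: in_cubesX3.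
Qed.

(** Over F_2, (a^2 + ab + b^2)(a + b) = a^3 + b^3. *)
Lemma edge_relation e a b : simple_graph e -> e a b ->
  in_cubes ((X a ^+ 2 + X a * X b + X b ^+ 2) * graph_poly e).
Proof.
move=> es eab; rewrite (graph_poly_del_edge es eab); set P := graph_poly _.
have -> : (X a ^+ 2 + X a * X b + X b ^+ 2) * ((X a + X b) * P) = X a ^+ 3 * P + X b ^+ 3 * P +
  ((X a ^+ 2 * X b + X a * X b ^+ 2) * P + (X a ^+ 2 * X b + X a * X b ^+ 2) * P) by ring.
by rewrite mpoly2_addxx addr0; apply: in_cubesD; apply: in_cubesMr; apply: in_cubesX3.
Qed.

End GraphPoly.

(** * Completion to a 2-tree *)

Section Completion.
Variable T : finType.
Implicit Types (e E : rel T) (A : {set T}).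
Local Notation R := {mpoly 'F_2[#|T|]}.
Implicit Types (Q : R).

Lemma graph_poly_edgeless e : (forall u w, ~~ e u w) -> graph_poly e = 1.
Proof.
by move=> e0; apply: big_pred0 => -[u w]; rewrite /ranked /= (negPf (e0 u w)).
Qed.

Lemma elim_free v (F0 F1 F2 F G : R) :
  var_free v F0 -> var_free v F1 -> var_free v F2 ->
  F = F0 + F1 * X v + F2 * X v ^+ 2 + G * X v ^+ 3 ->
  in_cubes F -> in_cubes F2.
Proof. exact: in_cubes_elim. Qed.

Lemma mulrn_addb (F : R) (p q : bool) : F *+ (p (+) q) = F *+ p + F *+ q.
Proof. by case: p q => [] []; rewrite ?addr0 ?add0r // mpoly2_addxx. Qed.

Definition cone E v a b : rel T :=
  [rel x y | [|| E x y, (x == v) && (y \in [:: a; b]) | (y == v) && (x \in [:: a; b])]].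

(** The two booleans are the coordinates in F_2 of a linear form in [X b] and [X c]; [mulrn_addb]
    turns exclusive or into addition. *)
Definition lin b c (l : bool * bool) : R := X b *+ l.1 + X c *+ l.2.

(* What is used of a 2-tree E on A through the edge bc: the map l to the three
   nonzero vectors of F_2^2 is its 3-colouring. *)
Definition completed A b c E : Prop :=
  [/\ simple_graph E, E b c, forall u w, E u w -> u \in A,
      forall u, u \in A -> exists w, E u w &
      ~~ in_cubes (X b ^+ 2 * X c * graph_poly E)] /\
  exists l : T -> bool * bool,
    (forall u, u \in A -> l u != (false, false) /\
       in_cubes ((X u + lin b c (l u)) * graph_poly E)) /\
    (forall u w, E u w -> l u != l w).

(** For a single edge, X_b^2 X_c (X_b + X_c) contains the monomial X_b^2 X_c^2, which is not in the
    ideal. *)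
Lemma completed_edge b c e : simple_graph e -> e b c ->
  (forall u w, e u w -> u \in [set b; c]) -> completed [set b; c] b c e.
Proof.
move=> es ebc supp; have bc : b != c by apply: contraTneq ebc => ->; rewrite es.2.
have ecb : e c b by rewrite es.1.
have Nb : nbrs e b = [set c].
  apply/setP => w; rewrite !inE; apply/idP/eqP => [ebw|-> //].
  have /supp : e w b by rewrite es.1.
  by rewrite !inE => /orP[] /eqP // wb; rewrite wb es.2 in ebw.
have Pe : graph_poly e = X b + X c.
  rewrite (graph_poly_leaf es Nb) graph_poly_edgeless ?mulr1 // => u w.
  rewrite /delv /=; apply/negP => /and3P[euw ub wb].
  have := supp _ _ euw; rewrite es.1 in euw; have := supp _ _ euw.
  rewrite !inE (negPf ub) (negPf wb) /= => /eqP wc /eqP uc.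
  by rewrite wc uc es.2 in euw.
split; first split=> //.
- by move=> u; rewrite !inE => /orP[] /eqP->; [exists c|exists b].
- apply/negP => H.
  have H1 : in_cubes (X c ^+ 2 : R).
    apply: (elim_free (v := b) (F0 := 0) (F1 := 0) (G := X c) _ _ _ _ H).
    + exact: free_of0.
    + exact: free_of0.
    + by apply: free_ofM; apply: freeX; rewrite eq_sym.
    + rewrite Pe; ring.
  have := @in_cubes1 #|T|; apply/negP; rewrite negbK.
  apply: (elim_free (v := c) (F0 := 0) (F1 := 0) (G := 0) _ _ _ _ H1).
  + exact: free_of0.
  + exact: free_of0.
  + exact: free_of1.
  + ring.
exists (fun u => if u == b then (true, false) else (false, true)); split.
  move=> u; rewrite !inE /lin; have [-> _|_ /= /eqP->] := eqVneq u b; split=> //=.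
    by rewrite addr0 mpoly2_addxx mul0r in_cubes0.
  by rewrite add0r mpoly2_addxx mul0r in_cubes0.
move=> u w euw; have := supp _ _ euw; rewrite !inE.
have [ub _|ub /= /eqP uc] := eqVneq u b; have [wb|wb] //= := eqVneq w b.
  by rewrite ub wb es.2 in euw.
rewrite es.1 in euw; have := supp _ _ euw; rewrite !inE (negPf wb) /= => /eqP wc.
by rewrite wc uc es.2 in euw.
Qed.

(** By the triangle relation the new vertex receives the sum of the vectors of [a1] and [a2]. These
    are distinct and nonzero, so the sum is the third nonzero vector. Non-membership persists
    because [v] has degree 2 and can be eliminated. *)
Lemma completed_cone A b c E v a1 a2 : completed A b c E -> v \notin A -> E a1 a2 ->
  completed (v |: A) b c (cone E v a1 a2).
Proof.
move=> [[Es Ebc supp nbr nz] [l [lA lE]]] vA Ea; have [Esym Eirr] := Es.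
have va u w : E u w -> u != v by move=> /supp uA; apply: contraTneq uA => ->.
have va' u w : E u w -> w != v by rewrite Esym; apply: va.
have [a1v a2v] := (va _ _ Ea, va' _ _ Ea).
have a12 : a1 != a2 by apply: contraTneq Ea => ->; rewrite Eirr.
have Cs : simple_graph (cone E v a1 a2).
  split=> [x y|x]; rewrite /cone /=.
    by rewrite Esym; congr (_ || _); rewrite orbC.
  rewrite Eirr /=; have [->|] //= := eqVneq x v.
  by rewrite !inE ![v == _]eq_sym (negPf a1v) (negPf a2v).
have Nv : nbrs (cone E v a1 a2) v = [set a1; a2].
  apply/setP => w; rewrite !inE /cone /= eqxx /= !inE.
  case Evw: (E v w); first by have := va _ _ Evw; rewrite eqxx.
  by rewrite ![v == _]eq_sym (negPf a1v) (negPf a2v) andbF orbF.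
have dE : delv (cone E v a1 a2) v =2 E.
  move=> x y; rewrite /delv /cone /=.
  case Exy: (E x y) => /=; first by rewrite (va _ _ Exy) (va' _ _ Exy).
  by have [->|] //= := eqVneq x v; rewrite ?andbF //; case: (y == v); rewrite ?andbF.
have PC : graph_poly (cone E v a1 a2) = (X v + X a1) * (X v + X a2) * graph_poly E.
  by rewrite (graph_poly_deg2 Cs a12 Nv) (eq_graph_poly dE).
have bv : b != v := va _ _ Ebc; have cv : c != v := va' _ _ Ebc.
have a1A : a1 \in A := supp _ _ Ea.
have a2A : a2 \in A by apply: (supp _ a1); rewrite Esym.
have Cva1 : cone E v a1 a2 v a1 by rewrite /cone /= eqxx !inE eqxx ?orbT.
have Cva2 : cone E v a1 a2 v a2 by rewrite /cone /= eqxx !inE eqxx ?orbT.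
have Ca12 : cone E v a1 a2 a1 a2 by rewrite /cone /= Ea.
split; first split=> //.
- by rewrite /cone /= Ebc.
- move=> x y; rewrite !inE /cone /= => /or3P[/supp->|/andP[-> _]|/andP[_]]; rewrite ?orbT //.
  by rewrite !inE => /orP[] /eqP->; rewrite ?a1A ?a2A orbT.
- move=> u /setU1P[->|/nbr[w Euw]]; first by exists a1.
  by exists w; rewrite /cone /= Euw.
- apply: contra nz => H; rewrite -(eq_graph_poly dE); apply: in_cubes_delv H => //.
    by rewrite Nv cards2 a12.
  by do 2 ?apply: free_ofM; apply: freeX.
pose m := ((l a1).1 (+) (l a2).1, (l a1).2 (+) (l a2).2).
have la12 := lE _ _ Ea; have [l10 _] := lA _ a1A; have [l20 _] := lA _ a2A.
exists (fun u => if u == v then m else l u); split.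
  move=> u /setU1P[->|uA]; last first.
    have -> : (u == v) = false by apply: contraNF vA => /eqP <-.
    have [lu Iu] := lA u uA; split=> //; rewrite PC mulrA mulrAC.
    exact: in_cubesMr.
  rewrite eqxx; split.
    by move: la12; rewrite /m; case: (l a1) (l a2) => [[] []] [[] []].
  have H0 := triangle_relation Cs Cva1 Ca12 Cva2.
  have Ia (a : T) : a \in A -> in_cubes ((X a + lin b c (l a)) * graph_poly (cone E v a1 a2)).
    by move=> aA; rewrite PC mulrA mulrAC; apply: in_cubesMr; apply: (lA a aA).2.
  have := in_cubesD H0 (in_cubesD (Ia _ a1A) (Ia _ a2A)).
  rewrite -!mulrDl; congr (is_true (in_cubes (_ * _))).
  have linD : lin b c m = lin b c (l a1) + lin b c (l a2).
    by rewrite /lin /m /= !mulrn_addb addrACA.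
  rewrite linD.
  have -> : X v + X a1 + X a2 + (X a1 + lin b c (l a1) + (X a2 + lin b c (l a2))) =
    X v + (lin b c (l a1) + lin b c (l a2)) + (X a1 + X a1) + (X a2 + X a2) by ring.
  by rewrite !mpoly2_addxx !addr0.
have m1 : m != l a1 by move: l20; rewrite /m; case: (l a1) (l a2) => [[] []] [[] []].
have m2 : m != l a2 by move: l10; rewrite /m; case: (l a1) (l a2) => [[] []] [[] []].
move=> u w; rewrite /cone /= => /or3P[Euw|/andP[/eqP->]|/andP[/eqP->]].
- by rewrite (negPf (va _ _ Euw)) (negPf (va' _ _ Euw)); apply: lE.
- by rewrite eqxx !inE => /orP[] /eqP->; rewrite ?(negPf a1v) ?(negPf a2v).
- by rewrite eqxx !inE => /orP[] /eqP->; rewrite ?(negPf a1v) ?(negPf a2v) eq_sym.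
Qed.

(** Induction on [A]: a low vertex [v] is contracted into a neighbour, the contraction is completed,
    and [v] is put back as a cone over an edge that contains its neighbours. *)
Lemma ex_completion A e b c : simple_graph e -> K4_minor_free e -> e b c ->
  (forall u w, e u w -> u \in A) ->
  exists E, completed A b c E /\ subrel e E.
Proof.
have [n] := ubnP #|A|; elim: n => // n IHn in A e *; rewrite ltnS => len.
move=> es Ke ebc supp; have [sym irr] := es.
have bA : b \in A := supp _ _ ebc.
have cA : c \in A by apply: (supp _ b); rewrite sym.
have lenD v : v \in A -> (#|A :\ v| < n)%N by move=> vA; rewrite (cardsD1 v A) vA add1n in len.
have [/subsetP Abc|] := boolP (A \subset [set b; c]).
  have AE : A = [set b; c].
    by apply/setP => u; apply/idP/idP => [/Abc //|]; rewrite !inE => /orP[] /eqP->.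
  by exists e; split=> // ; rewrite AE; apply: completed_edge => // u w /supp/Abc.
case/subsetPn => w wA; rewrite !inE negb_or => /andP[wb wc].
have [/existsP[v /and4P[vA vb vc /eqP v0]]|noiso] :=
    boolP [exists v, [&& v \in A, v != b, v != c & #|nbrs e v| == 0%N]].
  have nv u : ~~ e v u by have : u \notin nbrs e v; [rewrite (cards0_eq v0) inE|rewrite inE].
  have [|E [EA sE]] := IHn (A :\ v) e (lenD v vA) es Ke ebc.
    move=> u x eux; rewrite !inE (supp _ _ eux) andbT.
    by apply: contraTneq eux => ->.
  have [[_ Ebc _ _ _] _] := EA.
  (* An isolated vertex may be attached to any edge, here to [bc]. *)
  exists (cone E v b c); split; last by move=> x y /sE Exy; rewrite /cone /= Exy.
  by rewrite -(setD1K vA); apply: completed_cone; rewrite // !inE eqxx.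
have [|v /and4P[vb vc v0 v2]] := ex_low_vertex es Ke ebc wb wc.
  rewrite lt0n; apply: contra noiso => w0; apply/existsP; exists w.
  by rewrite wA wb wc.
have /card_gt0P[a] := v0; rewrite inE => eva.
have av : a != v by apply: contraTneq eva => ->; rewrite irr.
have vA : v \in A := supp _ _ eva.
have aA : a \in A by apply: (supp _ v); rewrite sym.
have [||E [EA sE]] := IHn (A :\ v) (contract e v a) (lenD v vA) (contract_simple v a es)
   (contract_K4_minor_free es eva Ke).
- by apply: contract_old => //; rewrite eq_sym.
- move=> x y /(contract_isolated sym eva)[xv /card_gt0P[y']]; rewrite !inE xv.
  exact: supp.
have finish a2 : E a a2 -> (forall x, e v x -> x \in [:: a; a2]) ->
    exists E', completed A b c E' /\ subrel e E'.
  move=> Ea Nv; exists (cone E v a a2); split.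
    by rewrite -(setD1K vA); apply: completed_cone; rewrite // !inE eqxx.
  move=> x y exy; rewrite /cone /=.
  have [xv|xv] := eqVneq x v; first by rewrite (Nv y) ?orbT // -xv.
  have [yv|yv] := eqVneq y v; first by rewrite (Nv x) ?orbT // -yv sym.
  by rewrite sE // contract_old.
have [/cards1P[a' Nv]|v1] := boolP (#|nbrs e v| == 1)%N.
  have aa' : a = a' by have : a \in nbrs e v; [rewrite inE|rewrite Nv => /set1P].
  (* With a single neighbour [a], any edge of the completion at [a] can carry the cone. *)
  have [[_ _ _ nbr _] _] := EA.
  have [|a2 Ea] := nbr a; first by rewrite !inE av.
  apply: (finish a2) => // x evx; have : x \in nbrs e v by rewrite inE.
  by rewrite Nv !inE aa' => ->.
have /cards2P[p [q [pq Nv]]] : (#|nbrs e v| == 2)%N by rewrite eqn_leq v2 ltn_neqAle eq_sym v1.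
have Nv' x : e v x = (x == p) || (x == q) by move/setP/(_ x): Nv; rewrite !inE.
have : (a == p) || (a == q) by rewrite -Nv'.
case/orP => /eqP aE.
  apply: (finish q) => [|x]; last by rewrite Nv' !inE aE.
  by apply: sE; apply: contract_new; rewrite ?Nv' ?aE ?eqxx ?orbT // eq_sym.
apply: (finish p) => [|x]; last by rewrite Nv' !inE aE orbC.
by apply: sE; apply: contract_new; rewrite ?Nv' ?aE ?eqxx ?orbT.
Qed.

Lemma linP b c (l : bool * bool) : l != (false, false) ->
  [\/ lin b c l = X b, lin b c l = X c | lin b c l = X b + X c].
Proof.
rewrite /lin; move: (X b) (X c) => B C; case: l => -[] [] /= l0.
- exact: Or33.
- by apply: Or31; rewrite mulr0n addr0.
- by apply: Or32; rewrite mulr0n add0r.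
- by [].
Qed.

(** Multiplying the quadratic relation by [B] identifies B^2 C with B C^2, and the cubes vanish. In
    each of the nine cases one of BKL, CKL is therefore congruent to B^2 C. *)
Lemma pairing_lin n (B C P K L : {mpoly 'F_2[n]}) :
  [\/ K = B, K = C | K = B + C] -> [\/ L = B, L = C | L = B + C] ->
  in_cubes (B ^+ 3 * P) -> in_cubes (C ^+ 3 * P) ->
  in_cubes ((B ^+ 2 + B * C + C ^+ 2) * P) ->
  in_cubes (B * K * L * P) -> in_cubes (C * K * L * P) ->
  in_cubes (B ^+ 2 * C * P).
Proof.
move=> HK HL B3 C3 BC Hb Hc.
have BCC : in_cubes (B * C ^+ 2 * P) -> in_cubes (B ^+ 2 * C * P).
  move=> H; apply: in_cubes_mod2 (B * C ^+ 2 * P + B ^+ 3 * P) _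
    (in_cubesD (in_cubesD H B3) (in_cubesMl B BC)); ring.
case: HK Hb Hc => -> Hb Hc; case: HL Hb Hc => -> Hb Hc.
- apply: in_cubes_mod2 0 _ Hc; ring.
- apply: in_cubes_mod2 0 _ Hb; ring.
- apply: in_cubes_mod2 (B ^+ 3 * P) _ (in_cubesD Hb B3); ring.
- apply: in_cubes_mod2 0 _ Hb; ring.
- apply: BCC; apply: in_cubes_mod2 0 _ Hb; ring.
- apply: BCC; apply: in_cubes_mod2 (C ^+ 3 * P) _ (in_cubesD Hc C3); ring.
- apply: in_cubes_mod2 (B ^+ 3 * P) _ (in_cubesD Hb B3); ring.
- apply: BCC; apply: in_cubes_mod2 (C ^+ 3 * P) _ (in_cubesD Hc C3); ring.
- apply: BCC; apply: in_cubes_mod2 (B ^+ 3 * P + B ^+ 2 * C * P) _ (in_cubesD Hb B3); ring.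
Qed.

(** In a 2-tree through [bc] the variables [X y] and [X z] become nonzero linear forms in [X b],
    [X c]. Then [pairing_lin] would put X_b^2 X_c times its graph polynomial into the ideal. *)
Lemma edge_pairing e b c y z : simple_graph e -> K4_minor_free e -> e b c ->
  in_cubes (X b * X y * X z * graph_poly e) ->
  in_cubes (X c * X y * X z * graph_poly e) -> False.
Proof.
move=> es Ke ebc Hb Hc.
have [|E [[[Es Ebc _ _ nz] [l [lA _]]] sE]] := ex_completion (A := setT) es Ke ebc.
  by move=> u w _; rewrite inE.
have [Q PE] := graph_poly_sub sE.
have [ly0 Hy] := lA y (in_setT y); have [lz0 Hz] := lA z (in_setT z).
move/negP: nz; apply; set P := graph_poly E in PE Hy Hz *.
have lift F : in_cubes (F * graph_poly e) -> in_cubes (F * P).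
  by rewrite PE mulrA => ?; apply: in_cubesMr.
have reduce F : in_cubes (F * X y * X z * graph_poly e) ->
    in_cubes (F * lin b c (l y) * lin b c (l z) * P).
  move/lift => H1; have H2 := in_cubesMl (F * X z) Hy.
  have := in_cubesD H1 (in_cubesD H2 (in_cubesMl (F * lin b c (l y)) Hz)).
  apply: in_cubes_mod2 (F * X y * X z * P + F * lin b c (l y) * X z * P) _; ring.
have {}Hb := reduce _ Hb; have {}Hc := reduce _ Hc.
have B3 : in_cubes (X b ^+ 3 * P) by exact/in_cubesMr/in_cubesX3.
have C3 : in_cubes (X c ^+ 3 * P) by exact/in_cubesMr/in_cubesX3.
exact: (pairing_lin (linP b c ly0) (linP b c lz0) B3 C3 (edge_relation Es Ebc) Hb Hc).
Qed.

(** Multiplication by the variables of the two ends of any edge reduces this to [edge_pairing].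
    Without edges the polynomial is a monomial with exponents at most 2. *)
Lemma pair_not_in_cubes e y z : simple_graph e -> K4_minor_free e ->
  in_cubes (X y * X z * graph_poly e) -> False.
Proof.
move=> es Ke H; case: (pickP (fun p : T * T => e p.1 p.2)) => [[b c] /= ebc|noE].
  apply: (edge_pairing (y := y) (z := z) es Ke ebc); rewrite -2!mulrA mulrA.
    by move: (in_cubesMl (X b) H); congr (is_true (in_cubes _)); ring.
  by move: (in_cubesMl (X c) H); congr (is_true (in_cubes _)); ring.
rewrite graph_poly_edgeless in H; last by move=> u w; rewrite (noE (u, w)).
have := @in_cubes1 #|T|; apply/negP; rewrite negbK.
have [yz|yz] := eqVneq y z.
  rewrite yz in H; apply: (elim_free (v := z) (F0 := 0) (F1 := 0) (G := 0) _ _ _ _ H).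
  - exact: free_of0.
  - exact: free_of0.
  - exact: free_of1.
  - ring.
have H1 : in_cubes (X z : R).
  apply: (elim_free (v := y) (F0 := 0) (F1 := 0) (G := 0) _ _ _ _ (in_cubesMl (X y) H)).
  - exact: free_of0.
  - exact: free_of0.
  - by apply: freeX; rewrite eq_sym.
  - ring.
apply: (elim_free (v := z) (F0 := 0) (F1 := 0) (G := 0) _ _ _ _ (in_cubesMl (X z) H1)).
- exact: free_of0.
- exact: free_of0.
- exact: free_of1.
- ring.
Qed.

End Completion.

(** * Elimination of special vertices *)

Section Diamonds.
Variable T : finType.
Implicit Types (e : rel T).

(** A homomorphic image of one diamond with ends [p] and [q], which may coincide; walks of this
    relation are chains of diamonds. *)
Definition diamond e : rel T :=
  [rel p q | [exists v, exists w, [&& e p v, e p w, e v w, e v q & e w q]]].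

Definition diamond_conn e : rel T := connect (diamond e).

Lemma diamond_conn_sym e : ssrbool.symmetric e -> ssrbool.symmetric (diamond_conn e).
Proof.
move=> es; apply: sym_connect_sym => p q; rewrite /diamond /=.
by apply/existsP/existsP => -[v /existsP[w /and5P[h1 h2 h3 h4 h5]]]; exists v; apply/existsP; exists w;
  apply/and5P; split=> //; rewrite es.
Qed.

Lemma diamond_conn_sub e e' x y : subrel e' e -> diamond_conn e' x y -> diamond_conn e x y.
Proof.
move=> sub; apply: connect_sub => p q /existsP[v /existsP[w /and5P[h1 h2 h3 h4 h5]]].
by apply: connect1; apply/existsP; exists v; apply/existsP; exists w; apply/and5P; split; apply: sub.
Qed.

Lemma ord3_third (a b c d : 'I_3) : a != b -> c != a -> c != b -> d != a -> d != b -> c = d.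
Proof.
by move=> ab ca cb da db; apply/val_inj; move: a b c d ab ca cb da db;
  do 4 (case=> [[|[|[|//]]] ?]).
Qed.

(** Both ends of a diamond take the one colour that its two middle vertices leave. *)
Lemma diamond_conn_color e (c : T -> 'I_3) x y : ssrbool.symmetric e -> proper_3_coloring e c ->
  diamond_conn e x y -> c x = c y.
Proof.
move=> es pc /connectP[s]; elim: s x => [x _ -> //|q s IHs x] /= /andP[xq /IHs IH] yE.
rewrite -(IH yE); have /existsP[v /existsP[w /and5P[h1 h2 h3 h4 h5]]] := xq.
by apply: (ord3_third (pc _ _ h3)); [exact: pc | exact: pc | |]; apply: pc; rewrite es.
Qed.

(** The form of feasibility carried through the induction, where special vertices may come to
    coincide. *)
Definition weakly_feasible e x y z : Prop :=
  ~~ (diamond_conn e x y && diamond_conn e y z) /\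
  exists2 c : T -> 'I_3, proper_3_coloring e c & [|| c x == c y, c y == c z | c x == c z].

Lemma weakly_feasible_sub e e' x y z : subrel e' e ->
  weakly_feasible e x y z -> weakly_feasible e' x y z.
Proof.
move=> sub [nd [c pc cE]]; split; last by exists c => // a b /sub/pc.
by apply: contra nd => /andP[/(diamond_conn_sub sub)-> /(diamond_conn_sub sub)->].
Qed.

Lemma weakly_feasible_swap e x y z : ssrbool.symmetric e ->
  weakly_feasible e x y z -> weakly_feasible e y x z.
Proof.
move=> es [nd [c pc cE]]; have ds := diamond_conn_sym es; split.
  apply: contra nd => /andP[yx xz]; rewrite ds yx /=.
  by apply: connect_trans yx xz.
by exists c => //; rewrite eq_sym; case/or3P: cE => ->; rewrite ?orbT.
Qed.

Lemma weakly_feasible_rot e x y z : ssrbool.symmetric e ->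
  weakly_feasible e x y z -> weakly_feasible e y z x.
Proof.
move=> es [nd [c pc cE]]; have ds := diamond_conn_sym es; split.
  apply: contra nd => /andP[yz zx]; rewrite yz andbT ds.
  by apply: connect_trans yz zx.
by exists c => //; case/or3P: cE => h; rewrite ?[c z == _]eq_sym ?[c y == c x]eq_sym h ?orbT.
Qed.

Lemma path_chain_of_diamonds e p s : path (diamond e) p s ->
  exists v w : nat -> T, diamond_hom e (size s) (nth p (p :: s)) v w.
Proof.
move=> /(pathP p) ps.
pose u := nth p (p :: s).
pose good i v w := [&& e (u i) v, e (u i) w, e v w, e v (u i.+1) & e w (u i.+1)].
(* The default [p] is never taken at indices along the path. *)
pose v i := odflt p [pick v | [exists w, good i v w]].
pose w i := odflt p [pick w | good i (v i) w].
exists v, w => i /ps /existsP[v0 h0].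
have : [exists w, good i (v i) w].
  by rewrite {1}/v; case: pickP => [//|/(_ v0)]; rewrite h0.
case/existsP => w0 h1; have : good i (v i) (w i).
  by rewrite /w; case: pickP => [//|/(_ w0)]; rewrite h1.
by case/and5P.
Qed.

Lemma feasible_weakly e x y z : feasible e x y z -> weakly_feasible e x y z.
Proof.
move=> [nc [c [pc c2]]]; split.
  apply/negP => /andP[/connectP[s1 p1 yE] /connectP[s2 p2 zE]]; apply: nc.
  have [|v [w h]] := @path_chain_of_diamonds e x (s1 ++ s2); first by rewrite cat_path p1 -yE.
  exists (size (s1 ++ s2)), (nth x (x :: s1 ++ s2)), v, w; split; first exact: h.
  move=> a.
  rewrite !inE => /orP[/orP[]|] /eqP->.
  - by exists 0%N.
  (* [y] is the vertex where the two concatenated chains meet. *)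
  - exists (size s1); first by rewrite size_cat leq_addr.
    by rewrite -cat_cons nth_cat /= ltnSn yE -last_nth.
  - exists (size (s1 ++ s2)) => //.
    by rewrite -last_nth last_cat -yE.
exists c => //; apply: contraTT c2; rewrite !negb_or => /and3P[xy yz xz].
by rewrite -ltnNge -setUA cardsU1 cards2 !inE negb_or xy xz yz.
Qed.

End Diamonds.

Ltac free_tac := repeat first [assumption | exact: free_of0 | apply: free_ofM | apply: free_ofD].

(** * Eliminating special vertices of degree two and a neighbour *)

Section Reductions.
Variable T : finType.
Implicit Types (e : rel T).
Local Notation R := {mpoly 'F_2[#|T|]}.
Implicit Types (Q : R).

(** The coefficient of the square of [X x] in X_x (X_x + X_a)(X_x + X_b) is X_a + X_b. *)
Lemma elim_special e x a b Q : simple_graph e -> a != b -> nbrs e x = [set a; b] ->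
  var_free x Q -> in_cubes (X x * Q * graph_poly e) ->
  in_cubes ((X a + X b) * Q * graph_poly (delv e x)).
Proof.
move=> es ab Nx fQ H.
have Nx' w : e x w = (w == a) || (w == b) by move/setP/(_ w): Nx; rewrite !inE.
have ax : a != x by apply/eqP => E; have := Nx' x; rewrite es.2 E eqxx.
have bx : b != x by apply/eqP => E; have := Nx' x; rewrite es.2 E eqxx orbT.
have fd := free_delv x es.
rewrite (graph_poly_deg2 es ab Nx) in H.
apply: (elim_free (v := x) (F0 := 0) (F1 := X a * X b * Q * graph_poly (delv e x))
   (G := Q * graph_poly (delv e x)) _ _ _ _ H).
- exact: free_of0.
- by do 3 ?apply: free_ofM => //; apply: freeX.
- by do 2 ?apply: free_ofM => //; apply: free_ofD; apply: freeX.
- ring.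
Qed.

Lemma nbrs_delv e x u : simple_graph e -> u != x -> nbrs (delv e x) u = nbrs e u :\ x.
Proof.
by move=> es ux; apply/setP => w; rewrite !inE /delv /= ux andbC.
Qed.

Lemma arcs_delv_lt e x w : e x w -> (#|arcs (delv e x)| < #|arcs e|)%N.
Proof.
move=> exw; apply: proper_card; apply/properP; split.
  by apply/subsetP => a; rewrite !inE => /and3P[].
by exists (x, w); rewrite inE //= /delv /= eqxx andbF.
Qed.

(** Eliminating [x] leaves (X_u + X_b)^2 (X_u + X_c) times the rest, which is free of [X u]. The
    coefficients at the square of [X u] and at [X u] itself are X_c and X_b^2. Together they
    contradict [edge_pairing] for the added edge [bc]. *)
Lemma special_at_degree3 e x y z u b c : simple_graph e -> K4_minor_free e ->
  x != y -> x != z -> u != x -> u != y -> u != z ->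
  nbrs e x = [set u; b] -> u != b -> nbrs (delv e x) u = [set b; c] -> b != c -> ~~ e b c ->
  in_cubes (X x * (X y * X z) * graph_poly e) -> False.
Proof.
move=> es Ke xy xz ux uy uz Nx ub Nu bc nbc H.
have f1 : var_free x (X y * X z) by apply: free_ofM; apply: freeX; rewrite eq_sym.
have {}H := elim_special es ub Nx f1 H.
have s1 := delv_simple x es; have K1 : K4_minor_free (delv e x) := delv_K4_minor_free Ke.
have s2 := delv_simple u s1.
have eu w : delv e x u w = (w == b) || (w == c) by move/setP/(_ w): Nu; rewrite !inE.
have bu : b != u by rewrite eq_sym.
have cu : c != u by apply/eqP => E; have := eu u; rewrite s1.2 E eqxx orbT.
rewrite (graph_poly_deg2 s1 bc Nu) in H.
have fK := free_delv u s1; set K := graph_poly _ in H fK.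
have fyz : var_free u (X y * X z) by apply: free_ofM; apply: freeX; rewrite eq_sym.
have fB := freeX bu; have fC := freeX cu.
have fyzK := free_ofM fyz fK.
have H1 : in_cubes (X c * (X y * X z) * K).
  have : in_cubes ((X c + X b + X b) * (X y * X z * K)).
    apply: (elim_free (v := u) (F0 := X b * X b * X c * (X y * X z * K))
      (F1 := (X b * X b + X b * X c + X b * X c) * (X y * X z * K)) (G := X y * X z * K) _ _ _ _ H).
    + by free_tac.
    + by free_tac.
    + by free_tac.
    + ring.
  apply: in_cubes_mod2 (X b * (X y * X z * K)) _; ring.
have H2 : in_cubes (X b * X b * (X y * X z) * K).
  (* Multiplying by [X u] first makes the linear coefficient in [X u] the one that is extracted. *)
  have : in_cubes ((X b * X b + X b * X c + X b * X c) * (X y * X z * K)).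
    apply: (elim_free (v := u) (F0 := 0) (F1 := X b * X b * X c * (X y * X z * K))
      (G := (X u + X c + X b + X b) * (X y * X z * K)) _ _ _ _ (in_cubesMl (X u) H)).
    + exact: free_of0.
    + by free_tac.
    + by free_tac.
    + ring.
  apply: in_cubes_mod2 (X b * X c * (X y * X z * K)) _; ring.
have K2 : K4_minor_free (add_edge (delv (delv e x) u) b c).
  by apply: bypass_K4_minor_free; rewrite // eu eqxx ?orbT.
have s3 := add_edge_simple s2 bc.
have P3 : graph_poly (add_edge (delv (delv e x) u) b c) = (X b + X c) * K.
  by apply: graph_poly_add_edge => //; rewrite /delv /= (negPf nbc).
have e3 : add_edge (delv (delv e x) u) b c b c by rewrite /add_edge /= mem_head orbT.
apply: (edge_pairing (y := y) (z := z) s3 K2 e3); rewrite P3.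
  apply: in_cubes_mod2 0 _ (in_cubesD H2 (in_cubesMl (X b) H1)); ring.
apply: in_cubes_mod2 0 _ (in_cubesMl (X b + X c) H1); ring.
Qed.

(** Eliminating [x] and [y] leaves (X_u + X_b)^2 (X_u + X_c)^2 times the rest, whose coefficient at
    the square of [X u] is (X_b + X_c)^2. With the edge relation for the added edge [bc] this gives
    membership for both X_b X_b X_z and X_c X_b X_z, against [edge_pairing]. *)
Lemma specials_at_degree4 e x y z u b c : simple_graph e -> K4_minor_free e ->
  x != y -> x != z -> y != z -> u != x -> u != y -> u != z ->
  nbrs e x = [set u; b] -> u != b ->
  nbrs (delv e x) y = [set u; c] -> u != c ->
  nbrs (delv (delv e x) y) u = [set b; c] -> b != c -> ~~ e b c ->
  in_cubes (X x * (X y * X z) * graph_poly e) -> False.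
Proof.
move=> es Ke xy xz yz ux uy uz Nx ub Ny uc Nu bc nbc H.
have f1 : var_free x (X y * X z) by apply: free_ofM; apply: freeX; rewrite eq_sym.
have {}H := elim_special es ub Nx f1 H.
have s1 := delv_simple x es; have K1 : K4_minor_free (delv e x) := delv_K4_minor_free Ke.
have s2 := delv_simple y s1; have K2 : K4_minor_free (delv (delv e x) y) := delv_K4_minor_free K1.
have s3 := delv_simple u s2.
have eu w : delv (delv e x) y u w = (w == b) || (w == c) by move/setP/(_ w): Nu; rewrite !inE.
have bu : b != u by rewrite eq_sym.
have cu : c != u by rewrite eq_sym.
have by_ : b != y by apply/eqP => E; have := eu y; rewrite /delv /= eqxx !andbF E eqxx.
have f2 : var_free y ((X u + X b) * X z).
  by apply: free_ofM; [apply: free_ofD|]; apply: freeX; rewrite // eq_sym.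
have {}H : in_cubes ((X u + X c) * ((X u + X b) * X z) * graph_poly (delv (delv e x) y)).
  by apply: (elim_special s1 uc Ny f2); apply: in_cubes_mod2 0 _ H; ring.
rewrite (graph_poly_deg2 s2 bc Nu) in H.
have fK := free_delv u s2; set K := graph_poly _ in H fK.
have fz : var_free u (X z) by apply: freeX; rewrite eq_sym.
have fB := freeX bu; have fC := freeX cu.
have fzK := free_ofM fz fK.
have H1 : in_cubes ((X b + X c) * (X b + X c) * (X z * K)).
  have : in_cubes ((X b * X b + X c * X c + (X b * X c + X b * X c) + (X b * X c + X b * X c)) * (X z * K)).
    apply: (elim_free (v := u) (F0 := X b * X b * X c * X c * (X z * K))
      (F1 := (X b * X b * X c + X b * X b * X c + X b * X c * X c + X b * X c * X c) * (X z * K))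
      (G := (X u + X b + X b + X c + X c) * (X z * K)) _ _ _ _ H).
    + by free_tac.
    + by free_tac.
    + by free_tac.
    + ring.
  apply: in_cubes_mod2 (X b * X c * (X z * K)) _; ring.
have K3 : K4_minor_free (add_edge (delv (delv (delv e x) y) u) b c).
  by apply: bypass_K4_minor_free; rewrite // eu eqxx ?orbT.
have s4 := add_edge_simple s3 bc.
have P3 : graph_poly (add_edge (delv (delv (delv e x) y) u) b c) = (X b + X c) * K.
  by apply: graph_poly_add_edge => //; rewrite /delv /= (negPf nbc).
have e3 : add_edge (delv (delv (delv e x) y) u) b c b c by rewrite /add_edge /= mem_head orbT.
have rel3 := in_cubesMl (X z) (edge_relation s4 e3); rewrite P3 in rel3.
have H2 : in_cubes (X c * X b * X z * ((X b + X c) * K)).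
  apply: in_cubes_mod2 _ _ (in_cubesD rel3 (in_cubesMl (X b + X c) H1)).
  instantiate (1 := (X b ^+ 2 + X c ^+ 2 + X b * X c) * X z * ((X b + X c) * K)); ring.
have H3 : in_cubes (X b * X b * X z * ((X b + X c) * K)).
  apply: in_cubes_mod2 (X c * X b * X z * ((X b + X c) * K)) _ (in_cubesD H2 (in_cubesMl (X b) H1)); ring.
by rewrite -P3 in H2 H3; apply: (edge_pairing s4 K3 e3 H3 H2).
Qed.

End Reductions.

(** * The minimal counterexample *)

Section Nonvanishing.
Variable T : finType.
Implicit Types (e : rel T).
Local Notation R := {mpoly 'F_2[#|T|]}.
Implicit Types (Q : R).

Lemma low_degree_cases e v : (0 < #|nbrs e v| <= 2)%N ->
  (exists a, nbrs e v = [set a]) \/ (exists a b, a != b /\ nbrs e v = [set a; b]).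
Proof.
case/andP=> v0 v2; have [/cards1P|v1] := boolP (#|nbrs e v| == 1)%N; first by left.
by right; apply/cards2P; rewrite eqn_leq v2 ltn_neqAle eq_sym v1.
Qed.

Definition vanishing e x y z : Prop :=
  weakly_feasible e x y z /\ in_cubes (X x * (X y * X z) * graph_poly e).

Lemma vanishing_swap e x y z : ssrbool.symmetric e -> vanishing e x y z -> vanishing e y x z.
Proof. by move=> es [/(weakly_feasible_swap es) f]; rewrite mulrCA. Qed.

Lemma vanishing_rot e x y z : ssrbool.symmetric e -> vanishing e x y z -> vanishing e y z x.
Proof.
move=> es [/(weakly_feasible_rot es) f H]; split; first exact: f.
by apply: in_cubes_mod2 0 _ H; ring.
Qed.

Lemma no_vanishing e x y z : simple_graph e -> K4_minor_free e -> ~ vanishing e x y z.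
Proof.
have [n] := ubnP #|arcs e|; elim: n => // n IHn in e x y z *; rewrite ltnS => len es Ke.
have [sym irr] := es; have dsym := diamond_conn_sym sym.
have smaller e' u w x' y' z' : simple_graph e' -> K4_minor_free e' ->
    (#|arcs e'| <= #|arcs (delv e u)|)%N -> e u w -> ~ vanishing e' x' y' z'.
  move=> s' K' le' euw; apply: IHn => //.
  by apply: leq_ltn_trans le' _; apply: leq_trans (arcs_delv_lt euw) len.
have ordinary v x' y' z' : vanishing e x' y' z' -> v != x' -> v != y' -> v != z' ->
    (0 < #|nbrs e v| <= 2)%N -> False.
  move=> [f H] vx vy vz v2; have /andP[/card_gt0P[w]] := v2; rewrite inE => evw _.
  apply: (@smaller (delv e v) v w x' y' z' (delv_simple v es) (delv_K4_minor_free Ke)) => //.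
  split; first by apply: weakly_feasible_sub f => ? ? /and3P[].
  apply: in_cubes_delv => //.
  by do 2 ?apply: free_ofM; apply: freeX; rewrite eq_sym.
(* Degree 0 or 1, or two non-adjacent neighbours, would leave only two special vertices, against
   [pair_not_in_cubes]. So the neighbours of [x'] form an edge, and it lies in no further
   triangle. *)
have clean x' y' z' : vanishing e x' y' z' -> x' != y' -> x' != z' ->
    (#|nbrs e x'| <= 2)%N -> exists a b, [/\ a != b, nbrs e x' = [set a; b], e a b &
      forall c, e a c -> e b c -> c = x'].
  move=> [f H] xy xz x2; have sd := delv_simple x' es.
  have fyz : var_free x' (X y' * X z') by apply: free_ofM; apply: freeX; rewrite eq_sym.
  have [x0|x0] := posnP #|nbrs e x'|.
    have ex w : ~~ e x' w.
      by have : w \notin nbrs e x'; [rewrite (cards0_eq x0) inE|rewrite inE].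
    exfalso; apply: (@pair_not_in_cubes _ e y' z') => //.
    apply: (elim_free (v := x') (F0 := 0) (F1 := 0) (G := 0) _ _ _ _ (in_cubesMl (X x') H)).
    - exact: free_of0.
    - exact: free_of0.
    - by apply: free_ofM => //; apply: free_graph_poly.
    - ring.
  have [[a Nx]|[a [b [ab Nx]]]] := low_degree_cases (e := e) (v := x') (introT andP (conj x0 x2)).
    exfalso; apply: (@pair_not_in_cubes _ (delv e x') y' z') => //; first exact: delv_K4_minor_free.
    rewrite (graph_poly_leaf es Nx) in H; have fd := free_delv x' es.
    have ax : a != x'.
      have : a \in nbrs e x' by rewrite Nx set11.
      by rewrite inE; apply: contraTneq => ->; rewrite irr.
    apply: (elim_free (v := x') (F0 := 0) (F1 := X a * (X y' * X z') * graph_poly (delv e x'))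
       (G := 0) _ _ _ _ H).
    - exact: free_of0.
    - by have fa := freeX ax; free_tac.
    - by free_tac.
    - ring.
  have H1 := elim_special es ab Nx fyz H.
  have Nx' w : e x' w = (w == a) || (w == b) by move/setP/(_ w): Nx; rewrite !inE.
  have exa : e x' a by rewrite Nx' eqxx.
  have exb : e x' b by rewrite Nx' eqxx orbT.
  have [eab|nab] := boolP (e a b); last first.
    exfalso; apply: (@pair_not_in_cubes _ (add_edge (delv e x') a b) y' z').
    - exact: add_edge_simple.
    - exact: bypass_K4_minor_free.
    - rewrite graph_poly_add_edge //; last by rewrite /delv /= (negPf nab).
      by rewrite mulrA [_ * (X a + X b)]mulrC.
  exists a, b; split=> // c eac ebc; apply/eqP; apply: contraT => cx; exfalso.
  apply: (@smaller (delv e x') x' a c y' z') => //; first exact: delv_K4_minor_free.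
  (* [x'] and [c] are opposite corners of a diamond, so replacing [x'] by [c] preserves weak
     feasibility. *)
  have exd : diamond_conn e x' c.
    apply: connect1; apply/existsP; exists a; apply/existsP; exists b.
    by apply/and5P; split.
  have sub : subrel (delv e x') e by move=> ? ? /and3P[].
  have [nd [col pc cE]] := f.
  have cxc : col x' = col c by apply: diamond_conn_color pc exd.
  split.
    split; last first.
      by exists col; [move=> ? ? /sub/pc | rewrite -cxc].
    apply: contra nd => /andP[/(diamond_conn_sub sub) cy /(diamond_conn_sub sub) ->].
    by rewrite andbT; apply: connect_trans exd cy.
  have ax : a != x' by apply: contraTneq exa => ->; rewrite irr.
  have bx : b != x' by apply: contraTneq exb => ->; rewrite irr.
  have tri : in_cubes ((X a + X b + X c) * graph_poly (delv e x')).
    by apply: triangle_relation; rewrite // /delv /= ?eab ?ebc ?eac ?ax ?bx ?cx.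
  apply: in_cubes_mod2 ((X a + X b) * (X y' * X z') * graph_poly (delv e x')) _
    (in_cubesD H1 (in_cubesMl (X y' * X z') tri)); ring.
(* An ordinary vertex [u] that becomes low once its special neighbour [x'] is deleted. *)
have single x' y' z' u : vanishing e x' y' z' -> x' != y' -> x' != z' ->
    u != x' -> u != y' -> u != z' -> (#|nbrs e x'| <= 2)%N -> e x' u ->
    (#|nbrs (delv e x') u| <= 2)%N -> False.
  move=> van xy xz ux uy uz x2 exu u2.
  have [a [b [ab Nx eab com]]] := clean x' y' z' van xy xz x2.
  wlog au : a b ab Nx eab com / u = a => [hw|].
    have : u \in nbrs e x' by rewrite inE.
    rewrite Nx !inE => /orP[] /eqP ua; first by apply: (hw a b).
    apply: (hw b a) => //; [by rewrite eq_sym|by rewrite setUC|by rewrite sym|by move=> c ? ?; apply: com].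
  subst a; have Nd := nbrs_delv es ux.
  have exb : e x' b by have : b \in nbrs e x'; [rewrite Nx !inE eqxx orbT|rewrite inE].
  have bx : b != x' by apply: contraTneq exb => ->; rewrite irr.
  have bN : b \in nbrs (delv e x') u by rewrite Nd !inE bx.
  have u0 : (0 < #|nbrs (delv e x') u|)%N by apply/card_gt0P; exists b.
  have [[a Nu]|[p [q [pq Nu]]]] := low_degree_cases (e := delv e x') (v := u) (introT andP (conj u0 u2)).
    apply: (ordinary u x' y' z') => //.
    rewrite (cardsD1 x') -Nd Nu cards1 inE; by case: (e u x').
  wlog bp : p q pq Nu / b = p => [hw|].
    move: bN; rewrite Nu !inE => /orP[] /eqP bE; first by apply: (hw p q).
    by apply: (hw q p) => //; [rewrite eq_sym|rewrite setUC].
  subst p; apply: (@special_at_degree3 _ e x' y' z' u b q) => //; last exact: van.2.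
  (* An edge [bq] would give a second triangle on the edge [ub], which [clean] forbids. *)
  have uq : q \in nbrs (delv e x') u by rewrite Nu !inE eqxx orbT.
  move: uq; rewrite Nd !inE => /andP[qx euq]; apply/negP => ebq.
  by rewrite (com q euq ebq) eqxx in qx.
(* A low vertex away from the doubled vertex must be [z']. A low vertex found after deleting [z'] is
   then handled by [single] or [ordinary]. *)
have double x' z' : x' != z' -> ~ vanishing e x' x' z'.
  move=> xz van; have zx : z' != x' by rewrite eq_sym.
  have van' := vanishing_rot sym (vanishing_rot sym van).
  have [w ezw] : exists w, e z' w.
    have [z2|z2] := leqP #|nbrs e z'| 2.
      have [a [b [_ Nz _ _]]] := clean z' x' x' van' zx zx z2.
      by exists a; have : a \in nbrs e z'; [rewrite Nz !inE eqxx|rewrite inE].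
    by have /card_gt0P[w] := ltn_trans (ltn0Sn 1) z2; rewrite inE; exists w.
  have [v vx v2] := ex_low_vertex_away x' es Ke ezw.
  have vz : v = z'.
    by apply/eqP; apply: contraT => vz; exfalso; apply: (ordinary v x' x' z').
  subst v; have z2 : (#|nbrs e z'| <= 2)%N by case/andP: v2.
  have [a [b [ab Nz eab com]]] := clean z' x' x' van' zx zx z2.
  have aN : a \in nbrs e z' by rewrite Nz !inE eqxx.
  have bN : b \in nbrs e z' by rewrite Nz !inE eqxx orbT.
  rewrite !inE in aN bN.
  have az : a != z' by apply: contraTneq aN => ->; rewrite irr.
  have bz : b != z' by apply: contraTneq bN => ->; rewrite irr.
  have e1ab : delv e z' a b by rewrite /delv /= eab az bz.
  have [u ux /andP[u0 u2]] := ex_low_vertex_away x' (delv_simple z' es) (delv_K4_minor_free Ke) e1ab.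
  have uz : u != z'.
    apply: contraTneq u0 => ->; rewrite -leqNgt leqn0 cards_eq0; apply/eqP/setP => s.
    by rewrite !inE /delv /= eqxx andbF.
  have [ezu|nzu] := boolP (e z' u); first exact: (single z' x' x' u).
  apply: (ordinary u x' x' z') => //.
  rewrite (cardsD1 z') inE sym (negPf nzu) -(nbrs_delv es uz).
  by rewrite add0n u0 u2.
have distinct x' y' z' : x' != y' -> y' != z' -> x' != z' ->
    (0 < #|nbrs e x'| <= 2)%N -> (0 < #|nbrs e y'| <= 2)%N -> ~ vanishing e x' y' z'.
  move=> xy yz xz /andP[x0 x2] /andP[y0 y2] van.
  have yx : y' != x' by rewrite eq_sym.
  have van' := vanishing_swap sym van.
  have [a [b [ab Nx eab comx]]] := clean x' y' z' van xy xz x2.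
  have [c [d [cd Ny ecd comy]]] := clean y' x' z' van' yx yz y2.
  have Nx' w : e x' w = (w == a) || (w == b) by move/setP/(_ w): Nx; rewrite !inE.
  have Ny' w : e y' w = (w == c) || (w == d) by move/setP/(_ w): Ny; rewrite !inE.
  have exa : e x' a by rewrite Nx' eqxx.
  have exb : e x' b by rewrite Nx' eqxx orbT.
  have sd := delv_simple x' es; have Kd : K4_minor_free (delv e x') := delv_K4_minor_free Ke.
  have Nyd := nbrs_delv es yx.
  have fyz : var_free x' (X y' * X z') by apply: free_ofM; apply: freeX; rewrite eq_sym.
  have sub2 : subrel (delv (delv e x') y') e by move=> ? ? /and3P[/and3P[]].
  have [exy|nxy] := boolP (e x' y').
    (* Adjacent [x'] and [y'] form a pendant triangle with a vertex [t]. Eliminating both turns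
       their variables into the square of [X t], so [t] is special twice. *)
    have [t [Nxt Nyt eyt]] : exists t, [/\ nbrs e x' = [set y'; t], nbrs (delv e x') y' = [set t] & e y' t].
      have [t [yt Nxt eyt]] : exists t, [/\ y' != t, nbrs e x' = [set y'; t] & e y' t].
        move: exy; rewrite Nx' => /orP[] /eqP E; first by exists b; rewrite E.
        by exists a; rewrite E eq_sym sym [[set b; a]]setUC.
      exists t; split=> //; apply/setP => w; rewrite Nyd !inE.
      have ext : e x' t by have : t \in nbrs e x'; [rewrite Nxt !inE eqxx orbT|rewrite inE].
      have tx : t != x' by apply: contraTneq ext => ->; rewrite irr.
      have eyx : e y' x' by rewrite sym.
      have Nyt : nbrs e y' = [set x'; t].
        apply/esym/eqP; rewrite eqEcard Ny !cards2 cd eq_sym tx andbT -Ny.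
        by apply/subsetP => r; rewrite !inE => /orP[] /eqP->.
      have -> : e y' w = (w == x') || (w == t) by move/setP/(_ w): Nyt; rewrite !inE.
      by have [->|] //= := eqVneq w x'; rewrite eq_sym (negPf tx).
    have yt : y' != t by apply: contraTneq eyt => ->; rewrite irr.
    have H1 := elim_special es yt Nxt fyz van.2.
    rewrite (graph_poly_leaf sd Nyt) in H1; have fK := free_delv y' sd.
    set K := graph_poly _ in H1 fK.
    have H2 : in_cubes (X t * (X t * X z') * K).
      have ft : var_free y' (X t) by apply: freeX; rewrite eq_sym.
      have fz : var_free y' (X z') by apply: freeX; rewrite eq_sym.
      apply: (elim_free (v := y') (F0 := 0) (F1 := 0) (G := (X y' + X t + X t) * X z' * K)
        _ _ _ _ (in_cubesMl (X y') H1)).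
      - exact: free_of0.
      - exact: free_of0.
      - by free_tac.
      - ring.
    apply: (@smaller (delv (delv e x') y') x' a t t z') => //.
    - exact: delv_simple.
    - exact: delv_K4_minor_free.
    - by apply/subset_leq_card/subsetP => -[p q]; rewrite !inE => /and3P[].
    split=> //; have [nd [col pc cE]] := van.1; split; last first.
      by exists col; [move=> ? ? /sub2/pc | rewrite eqxx].
    (* If [t] and [z'] were joined by diamonds they would share a colour, and [x'], [y'], [z'] would
       receive three different colours like the triangle. *)
    apply/negP => /andP[_ /(diamond_conn_sub sub2) tz].
    have colt := diamond_conn_color sym pc tz.
    have ext : e x' t by have : t \in nbrs e x'; [rewrite Nxt !inE eqxx orbT|rewrite inE].
    move: cE; rewrite -colt.
    by rewrite (negPf (pc _ _ exy)) (negPf (pc _ _ eyt)) (negPf (pc _ _ ext)).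
  have nyx : ~~ e y' x' by rewrite sym.
  have ay : a != y' by apply: contraNneq nxy => <-.
  have by_ : b != y' by apply: contraNneq nxy => <-.
  have ax : a != x' by apply: contraTneq exa => ->; rewrite irr.
  have bx : b != x' by apply: contraTneq exb => ->; rewrite irr.
  have e1ab : delv (delv e x') y' a b by rewrite /delv /= eab ax bx ay by_.
  (* This vertex is low after deleting [x'] and [y']. The cases are that it sees neither, one or
     both of them. *)
  have [u uz /andP[u0 u2]] := ex_low_vertex_away z' (delv_simple y' sd) (delv_K4_minor_free Kd) e1ab.
  have /card_gt0P[s] := u0; rewrite inE => /and3P[/and3P[eus ux _] uy _].
  have Nu : nbrs (delv (delv e x') y') u = nbrs e u :\ x' :\ y'.
    by rewrite nbrs_delv // nbrs_delv.
  have sm : forall t r, ~~ e t r -> nbrs e r :\ t = nbrs e r.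
    by move=> t r ntu; apply/setDidPl; rewrite disjoint_sym disjoints1 inE sym.
  have [exu|nxu] := boolP (e x' u); last first.
    rewrite sm // in Nu.
    have [eyu|nyu] := boolP (e y' u); last first.
      by apply: (ordinary u x' y' z') => //; rewrite Nu sm // in u0 u2; rewrite u0 u2.
    apply: (single y' x' z' u) => //; first by rewrite nbrs_delv // -Nu.
  have [eyu|nyu] := boolP (e y' u); last first.
    apply: (single x' y' z' u) => //; rewrite nbrs_delv //.
    by rewrite -(sm y' u) // setDDl setUC -setDDl -Nu.
  have [p [up Nxp eupp comp]] : exists p, [/\ u != p, nbrs e x' = [set u; p], e u p &
      forall w, e u w -> e p w -> w = x'].
    move: exu; rewrite Nx' => /orP[] /eqP E; first by exists b; rewrite E.
    by exists a; rewrite E eq_sym sym [[set b; a]]setUC; split=> // w ? ?; apply: comx.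
  have [q [uq Nyq euq comq]] : exists q, [/\ u != q, nbrs e y' = [set u; q], e u q &
      forall w, e u w -> e q w -> w = y'].
    move: eyu; rewrite Ny' => /orP[] /eqP E; first by exists d; rewrite E.
    by exists c; rewrite E eq_sym sym [[set d; c]]setUC; split=> // w ? ?; apply: comy.
  have exp_ : e x' p by have : p \in nbrs e x'; [rewrite Nxp !inE eqxx orbT|rewrite inE].
  have eyq : e y' q by have : q \in nbrs e y'; [rewrite Nyq !inE eqxx orbT|rewrite inE].
  have px : p != x' by apply: contraTneq exp_ => ->; rewrite irr.
  have py : p != y' by apply: contraNneq nxy => <-.
  have qx : q != x' by apply: contraNneq nyx => <-.
  have qy : q != y' by apply: contraTneq eyq => ->; rewrite irr.
  (* If [p] and [q] coincided, [x'] and [y'] would both complete a triangle on the same edge. *)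
  have pq : p != q.
    apply/eqP => E; have : x' = y'; last by move/eqP; rewrite (negPf xy).
    by apply: comq; [rewrite sym | rewrite -E sym].
  have Nupq : nbrs (delv (delv e x') y') u = [set p; q].
    apply/esym/eqP; rewrite eqEcard cards2 pq u2 andbT; apply/subsetP => w.
    by rewrite Nu !inE => /orP[] /eqP->; rewrite ?px ?py ?qx ?qy.
  apply: (@specials_at_degree4 _ e x' y' z' u p q) => //; last exact: van.2.
  - by rewrite Nyd -Nyq; apply: sm.
  - by apply/negP => epq; move: qx; rewrite (comp q euq epq) eqxx.
move=> van.
have [xy|xy] := eqVneq x y.
  rewrite -xy in van; have [xz|xz] := eqVneq x z; last exact: double van.
  (* Three equal vertices are joined by the empty chain. *)
  by have [[/negP[]]] := van; rewrite -xz /diamond_conn connect0.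
have [yz|yz] := eqVneq y z.
  rewrite -yz in van; apply: (double y x); first by rewrite eq_sym.
  exact: vanishing_rot sym van.
have [xz|xz] := eqVneq x z.
  by rewrite -xz in van; apply: (double x y xy (vanishing_rot sym (vanishing_rot sym van))).
have edge : exists p q, e p q.
  have [x2|x2] := leqP #|nbrs e x| 2.
    have [a [b [_ Nz eab _]]] := clean x y z van xy xz x2.
    by exists a, b.
  by have /card_gt0P[w] := ltn_trans (ltn0Sn 1) x2; rewrite inE; exists x, w.
have [p [q epq]] := edge.
have yx : y != x by rewrite eq_sym.
have zx : z != x by rewrite eq_sym.
have zy : z != y by rewrite eq_sym.
have special v : (0 < #|nbrs e v| <= 2)%N -> v \in [:: x; y; z].
  move=> v2; apply: contraT; rewrite !inE !negb_or => /and3P[vx vy vz]; exfalso.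
  exact: (ordinary v x y z).
(* Two different low vertices exist, and both are special; up to symmetry they are the first two
   arguments of [distinct]. *)
have [v vz v2] := ex_low_vertex_away z es Ke epq.
have [w wv w2] := ex_low_vertex_away v es Ke epq.
have vyz := vanishing_rot sym van; have vzx := vanishing_rot sym vyz.
have := special v v2; rewrite !inE (negPf vz) orbF => /orP[] /eqP E; subst v.
  have := special w w2; rewrite !inE (negPf wv) /= => /orP[] /eqP E; subst w.
    exact: (distinct x y z).
  by apply: (distinct z x y).
have := special w w2; rewrite !inE (negPf wv) /= => /orP[] /eqP E; subst w.
  exact: (distinct x y z).
exact: (distinct y z x).
Qed.

End Nonvanishing.

(** * From odd coefficients to AT-orientations *)

Section AlonTarsi.
Variable T : finType.
Implicit Types (e d : rel T) (J F : {set T * T}).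

(** The start of an arc after the arcs in [J] have been reversed. *)
Definition tail J (a : T * T) : T := if a \in J then a.2 else a.1.

Definition outdeg_mnm d J : 'X_{1..#|T|} :=
  (\sum_(a : T * T | d a.1 a.2) U_(enum_rank (tail J a)))%MM.

Lemma outdeg_mnmE d J v :
  outdeg_mnm d J (enum_rank v) = (\sum_(a : T * T | d a.1 a.2) (tail J a == v))%N.
Proof.
rewrite /outdeg_mnm mnm_sumE; apply: eq_bigr => a _.
by rewrite mnm1E (inj_eq enum_rank_inj).
Qed.

Lemma mcoeff_arcs_poly d m : (arcs_poly d)@_m =
  #|[set J : {set T * T} | (J \subset [set a | d a.1 a.2]) && (outdeg_mnm d J == m)]|%:R.
Proof.
(* Expanding the product, [J] collects the arcs that contribute their head. The values 0 and 1 off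
   [d] remove every [J] that is not a set of arcs of [d]. *)
pose F (a : T * T) : {mpoly 'F_2[#|T|]} := if d a.1 a.2 then X a.2 else 0.
pose G (a : T * T) : {mpoly 'F_2[#|T|]} := if d a.1 a.2 then X a.1 else 1.
have -> : arcs_poly d = \prod_(a : T * T) (F a + G a).
  rewrite /arcs_poly big_mkcond; apply: eq_bigr => a _; rewrite /F /G.
  by case: ifP => _; rewrite ?add0r // addrC.
rewrite bigA_distr raddf_sum /=; set S := [set J | _].
have -> : (#|S|%:R : 'F_2) = \sum_(J in S) 1 by rewrite sumr_const.
rewrite big_mkcond [RHS]big_mkcond /=.
apply: eq_bigr => J _; rewrite /S !inE.
have [/subsetP sJ|/subsetPn[a aJ]] := boolP (J \subset _); last first.
  rewrite inE => /negPf da; rewrite (bigD1 a) //= aJ /F da mul0r mcoeff0.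
  by rewrite ?if_same.
have -> : \prod_(i : T * T) (if i \in J then F i else G i) = 'X_[outdeg_mnm d J].
  rewrite /outdeg_mnm (big_morph (fun m => 'X_[m] : {mpoly 'F_2[#|T|]}) (@mpolyXD _ _) (@mpolyX0 _ _)).
  rewrite [RHS]big_mkcond; apply: eq_bigr => a _; rewrite /tail.
  case: ifP => aJ; last by [].
  by rewrite /F; have := sJ a aJ; rewrite inE => ->.
by rewrite mcoeffX /= mulrb.
Qed.

Lemma card_arcs_at (p : T * T -> T) J v :
  #|[set a in J | p a == v]| = (\sum_(a in J) (p a == v))%N.
Proof.
rewrite -sum1dep_card big_mkcond [RHS]big_mkcond; apply: eq_bigr => a _.
by case: (a \in J); case: (_ == _).
Qed.

(** Stated without subtraction: reversal changes the out-degree at [v] by the in-degree minus the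
    out-degree of [J], so out-degrees are preserved exactly when [J] is Eulerian. *)
Lemma outdeg_mnm_reverse d J v : J \subset [set a | d a.1 a.2] ->
  (outdeg_mnm d J (enum_rank v) + #|[set a in J | a.1 == v]| =
   outdeg_mnm d set0 (enum_rank v) + #|[set a in J | a.2 == v]|)%N.
Proof.
move=> /subsetP sJ; rewrite !card_arcs_at !outdeg_mnmE.
rewrite (bigID (mem J)) [in RHS](bigID (mem J)) /=.
have JE : (fun a : T * T => d a.1 a.2 && (a \in J)) =1 mem J.
  by move=> a /=; case aJ: (a \in J); rewrite ?andbF //; have := sJ a aJ; rewrite inE => ->.
rewrite !(eq_bigl _ _ JE).
have -> : (\sum_(a in J) (tail J a == v) = \sum_(a in J) (a.2 == v))%N.
  by apply: eq_bigr => a aJ; rewrite /tail aJ.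
have -> : (\sum_(a in J) (tail set0 a == v) = \sum_(a in J) (a.1 == v))%N.
  by apply: eq_bigr => a aJ; rewrite /tail inE.
have -> : (\sum_(a | d a.1 a.2 && (a \notin J)) (tail J a == v) =
           \sum_(a | d a.1 a.2 && (a \notin J)) (tail set0 a == v))%N.
  by apply: eq_bigr => a /andP[_ /negPf aJ]; rewrite /tail aJ inE.
by rewrite addnC addnCA addnC.
Qed.

(** The coefficient counts the Eulerian sub-digraphs modulo 2, where the signs in [diffD]
    disappear. *)
Lemma odd_outdeg_AT e d : simple_graph e -> orientation e d ->
  (graph_poly e)@_(outdeg_mnm d set0) != 0 -> AT_orientation d.
Proof.
move=> es od; rewrite -(arcs_poly_orientation es od) mcoeff_arcs_poly; apply: contra => /eqP D0.
have : ((diffD d)%:~R : 'F_2) = 0 by rewrite D0.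
rewrite /diffD rmorph_sum /= => E; apply/eqP; rewrite -[RHS]E -sumr_const.
apply: eq_big => [J|J _]; last first.
  rewrite rmorphXn rmorphN rmorph1.
  have -> : (-1 : 'F_2) = 1 by apply/val_inj.
  by rewrite expr1n.
rewrite inE /eulerian_sub.
have -> : [forall a in J, d a.1 a.2] = (J \subset [set a | d a.1 a.2]).
  by apply/forall_inP/subsetP => h a /h; rewrite inE.
have [sJ|//] := boolP (J \subset _); rewrite /=; apply/eqP/forallP => [mE v|h].
  by have := outdeg_mnm_reverse v sJ; rewrite mE => /addnI ->.
apply/mnmP => i; rewrite -(enum_valK i).
by have := outdeg_mnm_reverse (enum_val i) sJ; rewrite (eqP (h _)) => /addIn ->.
Qed.

Lemma outdegE d v : outdeg d v = (\sum_(a : T * T | d a.1 a.2) (a.1 == v))%N.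
Proof.
rewrite -(pair_big_dep xpredT d (fun u w => (u == v : nat))) /=.
rewrite (bigD1 v) //= [X in (_ + X)%N]big1 ?addn0 => [|u /negPf->]; last by rewrite big1.
by rewrite eqxx /outdeg -sum1_card; apply: eq_bigl => w; rewrite inE.
Qed.

(** A nonzero coefficient yields a set [J] of arcs whose reversal turns the ranked orientation into
    one with out-degrees [m]. *)
Lemma ex_AT_orientation e m : simple_graph e -> (graph_poly e)@_m != 0 ->
  exists2 d, orientation e d /\ AT_orientation d & forall v, outdeg d v = m (enum_rank v).
Proof.
move=> es Pm; have [sym irr] := es.
have : (arcs_poly (ranked e))@_m != 0 := Pm.
rewrite mcoeff_arcs_poly.
set S := [set J : {set T * T} | _] => S0.
have /card_gt0P[J] : (0 < #|S|)%N.
  rewrite lt0n; apply: contraNneq S0 => E.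
  by rewrite E.
rewrite inE => /andP[/subsetP sJ /eqP mJ].
pose d : rel T := [rel u v | (ranked e u v && ((u, v) \notin J)) || ((v, u) \in J)].
have ranked1 u v : ranked e u v -> ranked e v u = false.
  by case/andP => _ uv; rewrite /ranked /= [(_ < enum_rank u)%N]ltnNge (ltnW uv) andbF.
have rJ u v : (u, v) \in J -> ranked e u v by move/sJ; rewrite inE.
have od : orientation e d.
  split=> u v.
    by case/orP => [/andP[/andP[]]|/rJ/andP[]] //; rewrite sym.
  move=> euv; have uv : u != v by apply: contraTneq euv => ->; rewrite irr.
  have : ranked e u v || ranked e v u.
    by rewrite /ranked /= euv sym euv /= rank_neq //; case: (_ < _)%N.
  wlog r : u v euv uv / ranked e u v => [hw|_].
    by case/orP => r; [|rewrite eq_sym]; apply: hw; rewrite ?r // ?[v == u]eq_sym // sym.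
  rewrite /d /= r (ranked1 _ _ r) /=.
  have -> : (v, u) \in J = false by apply/negP => /rJ; rewrite ranked1.
  by rewrite orbF; case: ((u, v) \in J).
have dE v : outdeg d v = m (enum_rank v).
  rewrite -mJ outdeg_mnmE.
  rewrite outdegE.
  rewrite (bigID (fun a : T * T => ranked e a.1 a.2)) /= [RHS](bigID (mem J)) /= [RHS]addnC.
  congr (_ + _)%N.
    rewrite (eq_bigl (fun a : T * T => ranked e a.1 a.2 && (a \notin J))).
      by apply: eq_bigr => a /andP[_ /negPf aJ]; rewrite /tail aJ.
    case=> u w; rewrite /d /=; case r: (ranked e u w); rewrite ?andbF // andbT /=.
    by rewrite [X in _ || X](_ : _ = false) ?orbF //; apply/negP => /rJ; rewrite ranked1.
  pose sw (a : T * T) := (a.2, a.1).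
  rewrite (reindex_inj (h := sw)) /=; last by move=> [a b] [c f] [-> ->].
  apply: eq_big => [[u w]|[u w]]; rewrite /d /=; last first.
    by case/andP => dwu nr; move: dwu; rewrite (negPf nr) /tail /= => ->.
  case r: (ranked e w u).
    by rewrite /= andbF (ranked1 _ _ r).
  by rewrite andbT; apply/idP/andP => [uJ|[]//]; split=> //; apply: rJ.
exists d => //; split=> //; apply: (odd_outdeg_AT es od).
have -> : outdeg_mnm d set0 = m; last exact: Pm.
apply/mnmP => i; rewrite -(enum_valK i) -dE outdeg_mnmE.
by rewrite outdegE; apply: eq_bigr => a _; rewrite /tail inE.
Qed.
End AlonTarsi.

Local Close Scope ring_scope.

Theorem mainTheorem3 (T : finType) (e : rel T) (x y z : T) :
  simple_graph e -> K4_minor_free e ->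
  x != y -> y != z -> x != z ->
  feasible e x y z ->
  AT_extendable_222 e x y z.
Proof.
move=> es Ke xy yz xz /feasible_weakly feas.
have : ~~ in_cubes (X x * (X y * X z) * graph_poly e)%R.
  by apply/negP => H; apply: (no_vanishing es Ke (conj feas H)).
(* A monomial outside the ideal has all exponents at most 2. Removing the factor X_x X_y X_z leaves
   a monomial [m2] of the graph polynomial with exponents at most 1 at [x], [y], [z] and at most 2
   elsewhere. *)
case/allPn => m /msuppM_le /allpairsP[[m1 m2] /= [m1x m2P ->]] /existsPn small.
move: m1x; rewrite /X -!mpolyXD msuppX inE => /eqP m1E.
have [d [od ATd] degd] := ex_AT_orientation es (etrans (esym (mcoeff_msupp _ _)) m2P).
exists d; split=> // v; rewrite degd; have := small (enum_rank v).
rewrite m1E !mnmDE !mnm1E !(inj_eq enum_rank_inj) -leqNgt /f222.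
rewrite ![v == _]eq_sym; case: (x == v); case: (y == v); case: (z == v) => /=; lia.
Qed.
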